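(* Let $G_1$ be any hyperbolic graph and let $G_2$ be any graph. If $\delta(G_1\circ G_2)=\delta(G_1)+3/2$, then $G_1$ is a tree, $G_2$ is a non-trivial graph and $\delta(G_1\circ G_2)=3/2$.
   Context: All graphs are simple and connected (possibly infinite) and every edge has length $1$. A graph $G$ is viewed as a geodesic metric space by identifying each edge isometrically with $[0,1]$; points of $G$ are its vertices and the interior points of its edges, and $d_G$ is the length of a shortest path. A graph is trivial if it has a single vertex (this is regarded as a tree), and non-trivial otherwise. Lexicographic product $G_1\circ G_2$: vertex set $V(G_1)\times V(G_2)$; two distinct vertices $(u_1,v_1)$ and $(u_2,v_2)$ are adjacent if either $[u_1,u_2]\in E(G_1)$, or $u_1=u_2$ and $[v_1,v_2]\in E(G_2)$. A geodesic triangle $T=\{x_1,x_2,x_3\}$ in a geodesic metric space $X$ is the union of three geodesics $[x_1x_2],[x_2x_3],[x_3x_1]$. It is $\delta$-thin if every point of each side is at distance at most $\delta$ from the union of the other two sides; $\delta(T)=\inf\{\delta\ge 0: T \text{ is } \delta\text{-thin}\}$ and $\delta(X)=\sup\{\delta(T): T \text{ a geodesic triangle in } X\}\in[0,\infty]$. $X$ is hyperbolic if $\delta(X)<\infty$. *)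

(* Defs.v *)
From HB Require Import structures.
From mathcomp Require Import all_boot all_order all_algebra.
From mathcomp Require Import lra.
From mathcomp Require Import boolp classical_sets set_interval reals
  constructive_ereal ereal topology.

Set Implicit Arguments.
Unset Strict Implicit.
Unset Printing Implicit Defensive.

Import Order.TTheory GRing.Theory Num.Theory.
Local Open Scope classical_set_scope.
Local Open Scope ring_scope.

Record graph := Graph {
  vert :> eqType;
  adj : rel vert;
  adj_sym : symmetric adj;
  adj_irr : irreflexive adj;
  vert_inh : inhabited vert;
  adj_conn : forall u v : vert, exists2 p : seq vert, path adj u p & v = last u p
}.

Definition trivial_graph (G : graph) : Prop := exists v : G, forall w : G, w = v.

(* Connectedness being part of [graph], a tree is a graph without cycles. The
   bound on the size matters: the back-and-forth walk [:: u; v] along an edge is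
   a [ucycle]. *)
Definition is_tree (G : graph) : Prop :=
  forall c : seq G, ucycle (@adj G) c -> (size c < 3)%N.

Section lexicographic_product.
Variables G1 G2 : graph.

Definition lex_adj : rel (G1 * G2) :=
  fun x y => adj x.1 y.1 || (x.1 == y.1) && adj x.2 y.2.

Lemma lex_adj_sym : symmetric lex_adj.
Proof. by move=> x y; rewrite /lex_adj adj_sym eq_sym (adj_sym x.2). Qed.

Lemma lex_adj_irr : irreflexive lex_adj.
Proof. by move=> x; rewrite /lex_adj !adj_irr andbF. Qed.

Lemma lex_inh : inhabited (G1 * G2)%type.
Proof. by case: (vert_inh G1) => a; case: (vert_inh G2) => b; constructor. Qed.

Lemma lex_conn (x y : G1 * G2) :
  exists2 p : seq (G1 * G2), path lex_adj x p & y = last x p.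
Proof.
case: x y => [u1 u2] [v1 v2].
have [p1 p1P ->] := adj_conn u1 v1; have [p2 p2P ->] := adj_conn u2 v2.
exists ([seq (u1, w) | w <- p2] ++ [seq (w, last u2 p2) | w <- p1]).
  rewrite cat_path (last_map (fun w => (u1, w))).
  apply/andP; split.
    elim: p2 (u2) p2P => //= w p2 IH z /andP[zw /IH ->].
    by rewrite /lex_adj /= zw eqxx orbT.
  elim: p1 (u1) p1P => //= w p1 IH z /andP[zw /IH ->].
  by rewrite /lex_adj /= zw.
by rewrite last_cat (last_map (fun w => (u1, w))) (last_map (fun w => (w, _))).
Qed.

Definition lex_product : graph :=
  Graph lex_adj_sym lex_adj_irr lex_inh lex_conn.

End lexicographic_product.

Section realization.
Variables (R : realType) (G : graph).

(* Barycentric coordinates: a point is a vertex, or an interior point of an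
   edge [u, v], with weight f u on u and f v on v; it then lies at distance f v
   from u and f u from v. *)
Definition is_vertex (f : G -> R) (v : G) : Prop :=
  f v = 1 /\ forall w, w != v -> f w = 0.

Definition is_interior (f : G -> R) (u v : G) : Prop :=
  [/\ adj u v, 0 < f u, 0 < f v, f u + f v = 1
    & forall w, w != u -> w != v -> f w = 0].

Record gpoint := GPoint {
  bary :> G -> R;
  baryP : (exists v, is_vertex bary v) \/ (exists u v, is_interior bary u v)
}.

Definition on_edge (u v : G) (x : gpoint) : Prop :=
  adj u v /\ forall w, w != u -> w != v -> x w = 0.

(* [pl_path x y l]: there is a path of length l from x to y made of finitely
   many segments, each contained in a closed edge. *)
Inductive pl_path : gpoint -> gpoint -> R -> Prop :=
| pl_nil x : pl_path x x 0
| pl_cons u v x y z l : on_edge u v x -> on_edge u v y ->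
    pl_path y z l -> pl_path x z (`|x u - y u| + l).

Definition gdist (x y : gpoint) : R := inf [set l | pl_path x y l].

Lemma gpoint_inj (x y : gpoint) : (forall w, x w = y w) -> x = y.
Proof.
case: x y => [f fP] [g gP] /= fg.
have E : f = g by apply/funext.
by case: _ / E gP => gP; congr GPoint; exact: Prop_irrelevance.
Qed.

Lemma vertex_pointP (v : G) :
  (exists v', is_vertex (fun w => (w == v)%:R) v') \/
  (exists u u', is_interior (fun w => (w == v)%:R) u u').
Proof. by left; exists v; split=> [|w /negPf ->]; rewrite ?eqxx. Qed.

Definition vertex_point (v : G) : gpoint := GPoint (vertex_pointP v).

Lemma on_edge_sum u v x : on_edge u v x -> x u + x v = 1.
Proof.
move=> [uv x0].
have neq : u != v by apply: contraTneq uv => ->; rewrite adj_irr.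
case: (baryP x) => [[a [xa xa0]]|[a [b [ab a_gt0 b_gt0 sum1 xab0]]]].
  have : (a == u) || (a == v).
    apply/negPn; rewrite negb_or; apply/negP => /andP[au av].
    by move: xa; rewrite x0// => /eqP; rewrite eq_sym oner_eq0.
  case/orP => /eqP E; rewrite {a}E in xa xa0.
    by rewrite xa xa0 ?addr0 // eq_sym.
  by rewrite xa xa0 ?add0r.
have inuv w : 0 < x w -> (w == u) || (w == v).
  move=> w_gt0; apply/negPn; rewrite negb_or; apply/negP => /andP[wu wv].
  by rewrite x0// ltxx in w_gt0.
have nab : a != b by apply: contraTneq ab => ->; rewrite adj_irr.
case/orP: (inuv _ a_gt0) => /eqP ea; case/orP: (inuv _ b_gt0) => /eqP eb;
  move: nab sum1; rewrite ea eb ?eqxx // => _.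
by rewrite addrC.
Qed.

Lemma on_edge_dist_sym u v x y : on_edge u v x -> on_edge u v y ->
  `|x v - y v| = `|x u - y u|.
Proof.
move=> /on_edge_sum xs /on_edge_sum ys.
have -> : x v - y v = - (x u - y u) by lra.
by rewrite normrN.
Qed.

Lemma pl_path_ge0 x y l : pl_path x y l -> 0 <= l.
Proof. by elim=> {x y l} // *; apply: addr_ge0. Qed.

Lemma pl_path_cat x y z l m :
  pl_path x y l -> pl_path y z m -> pl_path x z (l + m).
Proof.
elim=> {x y l} [x|u v x y y' l xe ye _ IH] mP; first by rewrite add0r.
by rewrite -addrA; apply: pl_cons xe ye (IH mP).
Qed.

Lemma pl_path_edge u v x y : on_edge u v x -> on_edge u v y ->
  pl_path x y `|x u - y u|.
Proof. by move=> xe ye; rewrite -[`|_|]addr0; apply: pl_cons xe ye (pl_nil _). Qed.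

Lemma pl_path_rev x y l : pl_path x y l -> pl_path y x l.
Proof.
elim=> {x y l} [x|u v x y z l xe ye _ IH]; first exact: pl_nil.
by rewrite addrC distrC; apply: pl_path_cat IH (pl_path_edge ye xe).
Qed.

Lemma pl_path_lip x y l (w : G) : pl_path x y l -> `|x w - y w| <= l.
Proof.
elim=> {x y l} [x|u v x y z l xe ye _ IH]; first by rewrite subrr normr0.
apply: le_trans (ler_distD (y w) _ _) _; apply: lerD => //.
have [->//|wu] := eqVneq w u.
have [->|wv] := eqVneq w v; first by rewrite (on_edge_dist_sym xe ye).
by case: xe ye => _ xe [_ ye]; rewrite xe// ye// subrr normr0.
Qed.

Lemma vertex_on_edgel u v : adj u v -> on_edge u v (vertex_point u).
Proof. by move=> uv; split=> // w /negPf /= ->. Qed.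

Lemma vertex_on_edger u v : adj u v -> on_edge u v (vertex_point v).
Proof. by move=> uv; split=> // w /= _ /negPf ->. Qed.

Lemma pl_path_to_vertex x : exists v l, pl_path x (vertex_point v) l.
Proof.
case: (baryP x) => [[v [xv x0]]|[u [v [uv _ _ _ x0]]]].
  exists v, 0; suff <- : x = vertex_point v by apply: pl_nil.
  by apply: gpoint_inj => w /=; case: eqVneq => [->|/x0].
exists u; eexists; apply: pl_path_edge (vertex_on_edgel uv).
by split.
Qed.

Lemma pl_path_exists x y : exists l, pl_path x y l.
Proof.
have [u [l xu]] := pl_path_to_vertex x.
have [v [m /pl_path_rev vy]] := pl_path_to_vertex y.
suff [k uv] : exists k, pl_path (vertex_point u) (vertex_point v) k.
  by exists (l + (k + m)); apply: pl_path_cat xu (pl_path_cat uv vy).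
have [p pP ->] := adj_conn u v.
elim: p u pP {xu} => [|w p IH] u /=; first by exists 0; apply: pl_nil.
case/andP=> uw /IH[k wk]; eexists; apply: pl_path_cat wk.
exact: pl_path_edge (vertex_on_edgel uw) (vertex_on_edger uw).
Qed.

Lemma pl_path_nonempty x y : [set l | pl_path x y l] !=set0.
Proof. exact: pl_path_exists. Qed.

Lemma gdist_le x y l : pl_path x y l -> gdist x y <= l.
Proof. by move=> xy; apply: ge_inf => //; exists 0 => m /= /pl_path_ge0. Qed.

Lemma gdist_ge x y m : (forall l, pl_path x y l -> m <= l) -> m <= gdist x y.
Proof. by move=> H; apply: lb_le_inf (pl_path_nonempty x y) _. Qed.

Lemma gdistxx x : gdist x x = 0.
Proof.
apply/le_anti/andP; split; first exact: gdist_le (pl_nil x).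
by apply: gdist_ge => l /pl_path_ge0.
Qed.

Lemma gdist_edge u v x y : on_edge u v x -> on_edge u v y ->
  gdist x y = `|x u - y u|.
Proof.
move=> xe ye; apply/le_anti/andP; split; first exact: gdist_le (pl_path_edge xe ye).
by apply: gdist_ge => l; apply: pl_path_lip.
Qed.

Lemma gdist_positivity x y : gdist x y = 0 -> x = y.
Proof.
move=> d0; apply: gpoint_inj => w; apply/eqP; rewrite -subr_eq0 -normr_le0 -d0.
by apply: gdist_ge => l; apply: pl_path_lip.
Qed.

Lemma gdist_sym x y : gdist x y = gdist y x.
Proof.
by apply/le_anti/andP; split; apply: gdist_ge => l /pl_path_rev /gdist_le.
Qed.

Lemma gdist_triangle y x z : gdist x z <= gdist x y + gdist y z.
Proof.
rewrite -lerBlDr; apply: gdist_ge => l xy.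
rewrite lerBlDr -lerBlDl; apply: gdist_ge => m yz.
by rewrite lerBlDl; apply: gdist_le (pl_path_cat xy yz).
Qed.

HB.instance Definition _ := gen_eqMixin gpoint.
HB.instance Definition _ := gen_choiceMixin gpoint.
HB.instance Definition _ :=
  @isMetric.Build R gpoint gdist gdistxx gdist_positivity gdist_sym
    gdist_triangle.

End realization.

Definition metric_graph (R : realType) (G : graph) : metricType R := gpoint R G.

Section hyperbolicity.
Variables (R : realType) (X : metricType R).

(* [S] is the image of a geodesic from [x] to [y]. *)
Definition geodesic (x y : X) (S : set X) : Prop :=
  exists (L : R) (g : R -> X),
    [/\ 0 <= L, g 0 = x, g L = y, S = g @` `[0, L]
      & {in `[0, L] &, forall s t, mdist (g s) (g t) = `|s - t|}].

Definition geodesic_triangle (A B C : set X) : Prop :=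
  exists x1 x2 x3 : X,
    [/\ geodesic x1 x2 A, geodesic x2 x3 B & geodesic x3 x1 C].

Definition set_dist (p : X) (S : set X) : R := inf [set mdist p q | q in S].

Definition thin (A B C : set X) (r : R) : Prop :=
  [/\ forall p, A p -> set_dist p (B `|` C) <= r,
      forall p, B p -> set_dist p (C `|` A) <= r
    & forall p, C p -> set_dist p (A `|` B) <= r].

Definition triangle_delta (A B C : set X) : \bar R :=
  ereal_inf [set r%:E | r in [set r | 0 <= r /\ thin A B C r]].

Definition hyp_const : \bar R :=
  ereal_sup [set d | exists A B C : set X,
    geodesic_triangle A B C /\ d = triangle_delta A B C].

Definition hyperbolic : Prop := (hyp_const < +oo)%E.

End hyperbolicity.

Definition delta (R : realType) (G : graph) : \bar R :=
  hyp_const (metric_graph R G).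

(* Main.v *)
(** The projection [proj] of the product onto [G1] is 1-Lipschitz, and it only
    shortens the distance of two points when both lie on edges meeting a common
    fibre; two such points of horizontal edges are at distance at most 2. Hence
    a point of a geodesic triangle of the product is within 2 of a corner, or
    lies on a long side which projects onto a geodesic of [G1]. In the second
    case the two other sides either project onto geodesics or are so short that
    a point of [G1] close to their projected ends can be lifted to one of their
    ends at a cost of at most 1. This yields
    delta(G1 o G2) <= max(2, delta(G1) + 1), up to an arbitrarily small error.

    A vertex of a cycle which is farthest from a root has two parents in the
    breadth-first levels, or lies on an edge joining two vertices of equal
    level; geodesics to the root then form a bigon showing delta(G1) >= 3/4 when
    [G1] is not a tree, and delta(G1) + 3/2 exceeds the previous bound.

    A tree has delta = 0: given an edge [a, b], the function
    q |-> d(q, a) - d(q, b) takes its values in [-1, 1], the values other than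
    -1 and 1 exactly once, on the edge, so by the intermediate value theorem two
    sides of a triangle pass through every interior point of the third. Finally
    the product of a tree with a trivial graph is a tree. *)
Require Import Defs.
From mathcomp Require Import all_boot all_order all_algebra.
From mathcomp Require Import reals constructive_ereal topology.
From mathcomp Require Import lra zify.
From mathcomp Require Import boolp classical_sets ereal.
From mathcomp Require Import normedtype realfun.

Set Implicit Arguments.
Unset Strict Implicit.
Unset Printing Implicit Defensive.

Import Order.TTheory GRing.Theory Num.Theory numFieldNormedType.Exports.
Local Open Scope classical_set_scope.
Local Open Scope ring_scope.

(** * Combinatorial and geometric distances *)

Section walks.
Variable G : graph.
Implicit Types u v w : G.

Definition walk n u v := exists p, [/\ path (@adj G) u p, last u p = v & size p = n].

Lemma walk_exists u v : exists n, `[< walk n u v >].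
Proof.
have [p pP ->] := adj_conn u v.
by exists (size p); apply/asboolP; exists p.
Qed.

Definition dn u v : nat := ex_minn (walk_exists u v).

Lemma dn_walk u v : walk (dn u v) u v.
Proof. by rewrite /dn; case: ex_minnP => n /asboolP. Qed.

Lemma dn_le n u v : walk n u v -> (dn u v <= n)%N.
Proof. by move=> W; rewrite /dn; case: ex_minnP => m _; apply; apply/asboolP. Qed.

Lemma walk_cat m n u v w : walk m u v -> walk n v w -> walk (m + n) u w.
Proof.
move=> [p [pP <- <-]] [q [qP <- <-]]; exists (p ++ q).
by rewrite cat_path pP last_cat size_cat.
Qed.

Lemma walk_rev n u v : walk n u v -> walk n v u.
Proof.
move=> [p [pP <- <-]]; exists (rev (belast u p)).
split; last by rewrite size_rev size_belast.
  by rewrite rev_path (eq_path (e' := @adj G)) // => x y; rewrite adj_sym.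
by case: p {pP} => //= w p; rewrite rev_cons last_rcons.
Qed.

Lemma walk1 u v : adj u v -> walk 1 u v.
Proof. by move=> uv; exists [:: v]; split=> //=; rewrite uv. Qed.

Lemma dnn u : dn u u = 0%N.
Proof. by apply/eqP; rewrite -leqn0; apply: dn_le; exists [::]. Qed.

Lemma dn_eq0 u v : dn u v = 0%N -> u = v.
Proof. by move=> d0; have := dn_walk u v; rewrite d0 => -[[|? ?] [] //]. Qed.

Lemma dnC u v : dn u v = dn v u.
Proof.
by apply/eqP; rewrite eqn_leq !dn_le //; apply: walk_rev; apply: dn_walk.
Qed.

Lemma dn_triangle v u w : (dn u w <= dn u v + dn v w)%N.
Proof. by apply: dn_le; apply: walk_cat; apply: dn_walk. Qed.

Lemma dn_adj u v : adj u v -> (dn u v <= 1)%N.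
Proof. by move=> uv; apply: dn_le; apply: walk1. Qed.

Lemma dn_adjl u v w : adj u v -> (dn u w <= (dn v w).+1)%N.
Proof.
move=> /dn_adj uv; apply: leq_trans (dn_triangle v u w) _.
by rewrite -add1n leq_add2r.
Qed.

Lemma dn_adjr u v w : adj u v -> (dn w u <= (dn w v).+1)%N.
Proof. by rewrite !(dnC w); apply: dn_adjl. Qed.

Lemma dn_step n u v : dn u v = n.+1 -> exists2 w, adj u w & dn w v = n.
Proof.
move=> dE; have [p [pP pl ps]] := dn_walk u v; rewrite dE in ps.
case: p pP pl ps => //= w p /andP[uw wp] pl [ps].
exists w => //; apply/eqP; rewrite eqn_leq; apply/andP; split.
  by apply: dn_le; exists p.
by rewrite -ltnS -dE; apply: dn_adjl.
Qed.

Lemma adj_neq u v : adj u v -> u != v.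
Proof. by move=> uv; apply: contraTneq uv => ->; rewrite adj_irr. Qed.

End walks.

(** * Distances in the geometric realization *)

Section metric_graphs.
Variables (R : realType) (G : graph).
Notation X := (metric_graph R G).
Notation "# v" := (@vertex_point R G v) (at level 2, format "# v").
Implicit Types (u v w a b : G) (x y z p q : gpoint R G).
Local Notation dist := (@gdist R G).

Lemma mdistE x y : @mdist R X x y = dist x y.
Proof. by []. Qed.

Lemma gdist_ge0 x y : 0 <= dist x y.
Proof. by apply: gdist_ge => l /pl_path_ge0. Qed.

Lemma vertex_pointE v w : #v w = (w == v)%:R :> R.
Proof. by []. Qed.

Lemma vertex_pointpp v : #v v = 1 :> R.
Proof. by rewrite vertex_pointE eqxx. Qed.

Lemma vertex_pointpn v w : w != v -> #v w = 0 :> R.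
Proof. by rewrite vertex_pointE => /negPf ->. Qed.

Lemma on_edgeC u v x : on_edge u v x -> on_edge v u x.
Proof. by move=> [uv xz]; split=> [|w wv wu]; [rewrite adj_sym|apply: xz]. Qed.

Lemma bary_ge0 x w : 0 <= x w.
Proof.
case: (baryP x) => [[v [xv xz]]|[u [v [uv xu xv _ xz]]]].
  by have [->|/xz->//] := eqVneq w v; rewrite xv.
have [->|wu] := eqVneq w u; first exact: ltW.
by have [->|wv] := eqVneq w v; [apply: ltW|rewrite xz].
Qed.

Lemma bary_le1 x w : x w <= 1.
Proof.
case: (baryP x) => [[v [xv xz]]|[u [v [uv xu xv s xz]]]].
  by have [->|/xz->//] := eqVneq w v; rewrite xv.
have [->|wu] := eqVneq w u; first lra.
by have [->|wv] := eqVneq w v; [lra|rewrite xz].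
Qed.

Lemma on_edge_eq u v x y : on_edge u v x -> on_edge u v y -> x u = y u -> x = y.
Proof.
move=> xe ye xyu; apply: gpoint_inj => w.
have [->//|wu] := eqVneq w u.
have [->|wv] := eqVneq w v; last by rewrite xe.2 // ye.2.
by have := on_edge_sum xe; have := on_edge_sum ye; lra.
Qed.

Lemma bary1 x v : x v = 1 -> x = #v.
Proof.
move=> xv; case: (baryP x) => [[u [xu xz]]|[a [b [ab xa xb s xz]]]].
  have vu : v = u by apply/eqP; apply: contraPT xv => /xz ->; lra.
  apply: gpoint_inj => w; rewrite vertex_pointE.
  by have [->//|wv] := eqVneq w v; rewrite xz // -vu.
have [va|vna] := eqVneq v a; first by exfalso; move: xv; rewrite va; lra.
have [vb|vnb] := eqVneq v b; first by exfalso; move: xv; rewrite vb; lra.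
by exfalso; move: xv; rewrite xz //; lra.
Qed.

(** The weights of [x] sum to 1 on each of the two edges, so when these share a single vertex, all
    the weight sits there. *)
Lemma on_edge_cases u v a b x : on_edge u v x -> on_edge a b x ->
  [\/ x = #u, x = #v | (a = u /\ b = v) \/ (a = v /\ b = u)].
Proof.
move=> xe xab; have s := on_edge_sum xe; have s' := on_edge_sum xab.
have nab := adj_neq xab.1.
have [au|au] := eqVneq a u; have [bv|bv] := eqVneq b v.
- by apply: Or33; left.
- have bu : b != u by rewrite -au eq_sym.
  by apply: Or31; apply: bary1; move: s'; rewrite (xe.2 b) // au => ?; lra.
- have av : a != v by rewrite -bv.
  by apply: Or32; apply: bary1; move: s'; rewrite (xe.2 a) // bv => ?; lra.
have [av|av] := eqVneq a v; have [bu|bu] := eqVneq b u.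
- by apply: Or33; right.
- by apply: Or32; apply: bary1; move: s'; rewrite (xe.2 b) // av => ?; lra.
- by apply: Or31; apply: bary1; move: s'; rewrite (xe.2 a) // bu => ?; lra.
by exfalso; move: s'; rewrite !xe.2 //; lra.
Qed.

Lemma gdist_vertexl u v x : on_edge u v x -> dist x #u = x v.
Proof.
move=> xe; rewrite (gdist_edge xe (vertex_on_edgel R xe.1)) vertex_pointpp.
by have := on_edge_sum xe; have := bary_ge0 x v => ? ?; rewrite ler0_norm; lra.
Qed.

Lemma gdist_vertexr u v x : on_edge u v x -> dist x #v = x u.
Proof. by move=> /on_edgeC; apply: gdist_vertexl. Qed.

(** A path can leave a closed edge only through one of its ends. *)
Lemma gdist_cut u v x y : on_edge u v x ->
  [\/ on_edge u v y, dist x #u + dist #u y <= dist x y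
    | dist x #v + dist #v y <= dist x y].
Proof.
move=> xe; have [ye|nye] := pselect (on_edge u v y); first exact: Or31.
suff H l : pl_path x y l ->
    dist x #u + dist #u y <= l \/ dist x #v + dist #v y <= l.
  (* The end used may vary with the path, so it is the smaller of the two lengths that bounds every
     path from below. *)
  have [le|/ltW le] := leP (dist x #u + dist #u y) (dist x #v + dist #v y).
    by apply: Or32; apply: gdist_ge => l /H[//|]; apply: le_trans.
  by apply: Or33; apply: gdist_ge => l /H[|//]; apply: le_trans.
move=> P; elim: P xe nye => {x y l} [x //|a b x x' y l xab x'ab P IH] xe nye.
have le : dist x y <= `|x a - x' a| + l.
  by apply: gdist_le; exact: pl_cons xab x'ab P.
case: (on_edge_cases xe xab) => [xu|xv|ab].
- by left; rewrite xu gdistxx add0r -xu.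
- by right; rewrite xv gdistxx add0r -xv.
have x'e : on_edge u v x' by case: ab => -[<- <-] //; apply: on_edgeC.
rewrite -(gdist_edge xab x'ab).
by case: (IH x'e nye) => {}IH; [left|right];
  [have := gdist_triangle x' x #u|have := gdist_triangle x' x #v]; lra.
Qed.

Lemma gdist_vertex u v : dist #u #v = (dn u v)%:R.
Proof.
apply/le_anti/andP; split.
  apply: gdist_le; have [p [pP <- <-]] := dn_walk u v.
  elim: p u pP => [|w p IH] u /=; first by move=> _; apply: pl_nil.
  case/andP => uw /IH P; rewrite -natr1 addrC.
  have := pl_cons (vertex_on_edgel R uw) (vertex_on_edger R uw) P.
  by rewrite vertex_pointpp vertex_pointpn ?(adj_neq uw) // subr0 normr1.
apply: gdist_ge => l P.
(* Replacing the ends by variables with equations lets the induction on the path vary its starting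
   point. *)
have [x xE] : {x | x = #u} by exists #u.
have [y yE] : {y | y = #v} by exists #v.
rewrite -xE -yE in P.
(* Here [x b] is the distance from [x] to [a]. The invariant ranges over all edges containing [x],
   because a path may reach a vertex along one edge and leave it along another. *)
suff H : forall a b, on_edge a b x -> x b + (dn a v)%:R <= l \/ x a + (dn b v)%:R <= l.
  case: P xE yE H => {x y l} [x ->|a b x x' z l xe _ _ xu zv H].
    have [->|uv] := eqVneq u v; first by rewrite dnn.
    move/(congr1 (fun x => bary x u)); rewrite vertex_pointpp vertex_pointpn //.
    by move/eqP; rewrite oner_eq0.
  have := H _ _ xe.
  have [? ?] : x a = #u a /\ x b = #u b by rewrite xu.
  have : (u == a) || (u == b).
    apply/negPn; rewrite negb_or; apply/negP => /andP[ua ub].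
    by have := xe.2 u ua ub; rewrite xu vertex_pointpp; lra.
  have nab := adj_neq xe.1.
  have h1 := dn_adjl v xe.1.
  have h2 : (dn b v <= (dn a v).+1)%N by apply: dn_adjl; rewrite adj_sym; exact: xe.1.
  rewrite -(ler_nat R) -natr1 in h1; rewrite -(ler_nat R) -natr1 in h2.
  have nba : b != a by rewrite eq_sym.
  case/orP => /eqP E; subst u; rewrite xu vertex_pointpp vertex_pointpn //;
    by case => ?; lra.
elim: P yE {xE} => {x y l} [x|a b x x' y l xe x'e P IH] yE a' b' xe'.
  rewrite {x}yE in xe' *.
  have := on_edge_sum xe'.
  have : (v == a') || (v == b').
    apply/negPn; rewrite negb_or; apply/negP => /andP[ua ub].
    by have := xe'.2 v ua ub; rewrite vertex_pointpp; lra.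
  case/orP => /eqP E; subst v; rewrite dnn vertex_pointpp.
    by left; lra.
  by right; lra.
have s := on_edge_sum xe; have s' := on_edge_sum x'e; have s'' := on_edge_sum xe'.
(* The estimate holds first on the edge of the initial segment; it passes to any other edge
   containing [x], since [x] is then a common vertex. *)
have A : x b + (dn a v)%:R <= `|x a - x' a| + l \/ x a + (dn b v)%:R <= `|x a - x' a| + l.
  have N1 := ler_norm (x a - x' a).
  have N2 := ler_norm (- (x a - x' a)); rewrite normrN in N2.
  by case: (IH yE _ _ x'e) => ?; [left|right]; lra.
have l1 := dn_adjl v xe.1.
have l2 : (dn b v <= (dn a v).+1)%N by apply: dn_adjl; rewrite adj_sym; exact: xe.1.
rewrite -(ler_nat R) -natr1 in l1; rewrite -(ler_nat R) -natr1 in l2.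
case: (on_edge_cases xe xe') => [xa|xb|[[-> ->]//|[-> ->]]]; last by tauto.
- have xa1 : x a = 1 by rewrite xa vertex_pointpp.
  have : (a == a') || (a == b').
    apply/negPn; rewrite negb_or; apply/negP => /andP[ua ub].
    by have := xe'.2 a ua ub; lra.
  by case/orP => /eqP E; subst a; case: A => ?; [left|left|right|right]; lra.
have xb1 : x b = 1 by rewrite xb vertex_pointpp.
have : (b == a') || (b == b').
  apply/negPn; rewrite negb_or; apply/negP => /andP[ua ub].
  by have := xe'.2 b ua ub; lra.
by case/orP => /eqP E; subst b; case: A => ?; [left|left|right|right]; lra.
Qed.

End metric_graphs.

(** * Geodesics and thin triangles *)

Section geodesics.
Variables (R : realType) (X : metricType R).
Implicit Types (x y z p q : X) (S T : set X).
Local Notation dist := (@mdist R X).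

Definition iso_on (a b : R) (g : R -> X) :=
  {in `[a, b] &, forall s t, dist (g s) (g t) = `|s - t|}.

Lemma geodesic_left x y S : geodesic x y S -> S x.
Proof.
by move=> [L [g [L0 <- _ -> _]]]; exists 0 => //=; rewrite in_itv /= lexx.
Qed.

Lemma geodesic_sym x y S : geodesic x y S -> geodesic y x S.
Proof.
move=> [L [g [L0 gx gy SE iso]]]; exists L, (fun t => g (L - t)).
split=> //; rewrite ?subr0 ?subrr //.
  rewrite SE; apply/seteqP; split=> q [t /=]; rewrite in_itv /= => tL <-;
    exists (L - t) => //; rewrite ?in_itv /= ?subKr //; lra.
move=> s t; rewrite !in_itv /= => sL tL.
rewrite iso ?in_itv /=; try lra.
by rewrite [LHS]distrC; congr `|_|; lra.
Qed.

Lemma geodesic_right x y S : geodesic x y S -> S y.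
Proof. by move/geodesic_sym/geodesic_left. Qed.

Lemma geodesic_between x y S p : geodesic x y S -> S p ->
  dist x p + dist p y = dist x y.
Proof.
move=> [L [g [L0 gx gy SE iso]]]; rewrite SE => -[t /=].
rewrite in_itv /= => tL <-; rewrite -gx -gy !iso ?in_itv /=; try lra.
by rewrite !ler0_norm; lra.
Qed.

Lemma geodesic1 x : geodesic x x [set x].
Proof.
exists 0, (fun=> x); split=> //.
  by apply/seteqP; split=> q /=; [move=> ->; exists 0; rewrite //= in_itv /= lexx|case].
move=> s t; rewrite !in_itv /= => s0 t0; rewrite mdistxx.
by have -> : s - t = 0; rewrite ?normr0 //; lra.
Qed.

(** Only points on different pieces need care: a shortcut between them would bring [x] and [z]
    closer than the sum of the two lengths. *)
Lemma geodesic_cat x y z S T : geodesic x y S -> geodesic y z T ->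
  dist x z = dist x y + dist y z -> geodesic x z (S `|` T).
Proof.
move=> [L [g [L0 gx gy SE iso]]] [M [h [M0 hy hz TE hiso]]] dE.
have dL : dist x y = L by rewrite -gx -gy iso ?in_itv /= ?ler0_norm; lra.
have dM : dist y z = M by rewrite -hy -hz hiso ?in_itv /= ?ler0_norm; lra.
rewrite dL dM in dE.
pose k t := if t <= L then g t else h (t - L).
have kg t : t <= L -> k t = g t by rewrite /k => ->.
have kh t : L <= t -> k t = h (t - L).
  rewrite le_eqVlt /k => /predU1P[<-|]; first by rewrite lexx subrr gy hy.
  by rewrite leNgt => ->.
exists (L + M), k; split.
- lra.
- by rewrite kg.
- by rewrite kh; [rewrite addrC addKr|lra].
- rewrite SE TE; apply/seteqP; split=> q.
    case=> -[t /=]; rewrite in_itv /= => tL <-.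
      by exists t; rewrite ?kg //= ?in_itv /=; lra.
    exists (t + L); rewrite ?kh ?addrK //= ?in_itv /=; lra.
  move=> [t /=]; rewrite in_itv /= => tL <-.
  have [le|/ltW le] := leP t L.
    by left; exists t; rewrite ?kg //= in_itv /=; lra.
  by right; exists (t - L); rewrite ?kh //= in_itv /=; lra.
suff H s t : 0 <= s -> s <= t -> t <= L + M -> dist (k s) (k t) = t - s.
  move=> s t; rewrite !in_itv /= => sI tI.
  have [le|/ltW le] := leP s t.
    by rewrite H ?ler0_norm; lra.
  by rewrite metric_sym H ?ger0_norm; lra.
move=> s0 st tM; have [tL|/ltW tL] := leP t L.
  by rewrite !kg ?iso ?in_itv /= ?ler0_norm; lra.
have [sL|/ltW sL] := leP s L; last first.
  by rewrite !kh ?hiso ?in_itv /= ?ler0_norm; lra.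
rewrite (kg s) // kh //.
have e1 : dist (g s) y = L - s by rewrite -gy iso ?in_itv /= ?ler0_norm; lra.
have e2 : dist y (h (t - L)) = t - L by rewrite -hy hiso ?in_itv /= ?ler0_norm; lra.
have e3 : dist x (g s) = s by rewrite -gx iso ?in_itv /= ?ler0_norm; lra.
have e4 : dist (h (t - L)) z = L + M - t by rewrite -hz hiso ?in_itv /= ?ler0_norm; lra.
have t1 := metric_triangle (g s) y (h (t - L)).
have t2 := metric_triangle x (g s) z.
have t3 := metric_triangle (g s) (h (t - L)) z.
lra.
Qed.

(** A shortcut between [g s] and [g t] would bring the two ends closer than [L]. *)
Lemma lipschitz_iso (L : R) (g : R -> X) : 0 <= L ->
  {in `[0, L] &, forall s t, dist (g s) (g t) <= `|s - t|} ->
  L <= dist (g 0) (g L) -> iso_on 0 L g.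
Proof.
move=> L0 lip dL.
suff H s t : 0 <= s -> s <= t -> t <= L -> dist (g s) (g t) = t - s.
  move=> s t; rewrite !in_itv /= => sI tI.
  have [le|/ltW le] := leP s t.
    by rewrite H ?ler0_norm; lra.
  by rewrite metric_sym H ?ger0_norm; lra.
move=> s0 st tL.
have l1 : dist (g 0) (g s) <= `|0 - s| by apply: lip; rewrite in_itv /=; lra.
have l2 : dist (g s) (g t) <= `|s - t| by apply: lip; rewrite in_itv /=; lra.
have l3 : dist (g t) (g L) <= `|t - L| by apply: lip; rewrite in_itv /=; lra.
have t2 := metric_triangle (g 0) (g s) (g L).
have t3 := metric_triangle (g s) (g t) (g L).
move: l1 l2 l3; rewrite !ler0_norm; lra.
Qed.

Lemma triangle_delta_le (A B C : set X) (r : R) : 0 <= r -> thin A B C r ->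
  (triangle_delta A B C <= r%:E)%E.
Proof. by move=> r0 th; apply: ereal_inf_lbound; exists r. Qed.

Lemma triangle_delta_ge0 (A B C : set X) : (0 <= triangle_delta A B C)%E.
Proof. by apply: le_ereal_inf_tmp => _ [r [r0 _] <-]; rewrite lee_fin. Qed.

Lemma set_dist_le p S q (r : R) : S q -> dist p q <= r -> set_dist p S <= r.
Proof.
move=> Sq; apply: le_trans; apply: ge_inf; last by exists q.
by exists 0 => _ [z _ <-]; apply: mdist_ge0.
Qed.

Lemma set_dist_lt p S (r : R) : S !=set0 -> set_dist p S < r ->
  exists2 q, S q & dist p q < r.
Proof.
move=> [z Sz] lt; have [] := inf_lt _ lt.
  by exists (dist p z); exists z.
by move=> _ [q Sq <-] dq; exists q.
Qed.

Lemma hyp_const_ge0 : X -> (0 <= hyp_const X)%E.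
Proof.
move=> x; apply: (@le_trans _ _ (triangle_delta [set x] [set x] [set x])).
  exact: triangle_delta_ge0.
apply: ereal_sup_ubound; exists [set x], [set x], [set x]; split=> //.
by exists x, x, x; split; apply: geodesic1.
Qed.

(** By symmetry one side of each triangle is enough; the slack [e] allows approximate points. *)
Lemma hyp_const_le (r : R) : 0 <= r ->
  (forall x y z A B C, geodesic x y A -> geodesic y z B -> geodesic x z C ->
     forall p, A p -> forall e, 0 < e -> exists2 q, (B `|` C) q & dist p q < r + e) ->
  (hyp_const X <= r%:E)%E.
Proof.
move=> r0 H; apply: ge_ereal_sup => _ [A [B [C [[x [y [z [gA gB gC]]]] ->]]]].
apply: triangle_delta_le => //.
have K x' y' z' A' B' C' p : geodesic x' y' A' -> geodesic y' z' B' ->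
    geodesic x' z' C' -> A' p -> set_dist p (B' `|` C') <= r.
  move=> g1 g2 g3 A'p; apply/ler_addgt0Pr => e e0.
  have [q Bq /ltW] := H _ _ _ _ _ _ g1 g2 g3 p A'p e e0.
  exact: set_dist_le.
split=> p Sp.
- by apply: K gA gB (geodesic_sym gC) Sp.
- by apply: K gB gC (geodesic_sym gA) Sp.
- by apply: K gC gA (geodesic_sym gB) Sp.
Qed.

(** The slack [e] is there because neither the infimum in [triangle_delta] nor the one in [set_dist]
    need be attained. *)
Lemma hyp_const_thin (D : R) x y z A B C p e : hyp_const X = D%:E ->
  geodesic x y A -> geodesic y z B -> geodesic x z C -> A p -> 0 < e ->
  exists2 q, (B `|` C) q & dist p q < D + e.
Proof.
move=> hD gA gB gC Ap e0.
have : (triangle_delta A B C < (D + e)%:E)%E.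
  apply: (@le_lt_trans _ _ D%:E); last by rewrite lte_fin ltrDl.
  rewrite -hD; apply: ereal_sup_ubound; exists A, B, C; split=> //.
  by exists x, y, z; split=> //; apply: geodesic_sym.
move=> /ereal_inf_lt[_ [r [r0 [th _ _]] <-]]; rewrite lte_fin => rD.
apply: set_dist_lt; last exact: le_lt_trans (th p Ap) rD.
by exists y; left; apply: geodesic_left gB.
Qed.

End geodesics.

(** * Existence of geodesics in metric graphs *)

Section graph_geodesics.
Variables (R : realType) (G : graph).
Notation X := (metric_graph R G).
Notation "# v" := (@vertex_point R G v) (at level 2, format "# v").
Implicit Types (u v w a b : G) (x y z p q : gpoint R G).
Local Notation dist := (@gdist R G).

Lemma point_cases x :
  (exists v, x = #v) \/ (exists u v, [/\ on_edge u v x, 0 < x u & 0 < x v]).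
Proof.
case: (baryP x) => [[v [xv _]]|[u [v [uv xu xv _ xz]]]].
  by left; exists v; apply: bary1.
by right; exists u, v.
Qed.

Lemma edge_point u v (t : R) : adj u v -> 0 <= t <= 1 ->
  exists2 q : gpoint R G, on_edge u v q & q u = t.
Proof.
move=> uv /andP[]; rewrite le_eqVlt => /predU1P[<- _|t0].
  exists #v; first exact: vertex_on_edger.
  by rewrite vertex_pointpn ?adj_neq.
rewrite le_eqVlt => /predU1P[->|t1].
  by exists #u; [exact: vertex_on_edgel|rewrite vertex_pointpp].
have nvu : v != u by rewrite eq_sym adj_neq.
pose f w : R := if w == u then t else if w == v then 1 - t else 0.
have fu : f u = t by rewrite /f eqxx.
have fv : f v = 1 - t by rewrite /f eqxx (negPf nvu).
have f0 w : w != u -> w != v -> f w = 0 by rewrite /f => /negPf -> /negPf ->.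
have fP : (exists v, is_vertex f v) \/ (exists u v, is_interior f u v).
  by right; exists u, v; split; rewrite ?fu ?fv //; lra.
by exists (GPoint fP); first split.
Qed.

Lemma geodesic_edge u v x y : on_edge u v x -> on_edge u v y -> x u <= y u ->
  geodesic (x : X) y [set q | on_edge u v q /\ x u <= q u <= y u].
Proof.
move=> xe ye xy.
have x0 := bary_ge0 x u; have y1 := bary_le1 y u.
(* For a weight outside [[0, 1]] the point is [x] by default, so that [choice] applies to all
   reals. *)
have H t : exists q, on_edge u v q /\ (0 <= t <= 1 -> q u = t).
  have [/(edge_point xe.1)[q qe qt]|nt] := boolP (0 <= t <= 1); first by exists q.
  by exists x.
have [k kP] := choice H.
exists (y u - x u), (fun t => k (x u + t)); split.
- lra.
- by apply: (on_edge_eq (kP _).1 xe); rewrite (kP _).2; lra.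
- by apply: (on_edge_eq (kP _).1 ye); rewrite (kP _).2; lra.
- apply/seteqP; split=> q /=.
    move=> [qe qI]; exists (q u - x u); first by rewrite /= in_itv /=; lra.
    by apply: (on_edge_eq (kP _).1 qe); rewrite (kP _).2; lra.
  move=> [t]; rewrite /= in_itv /= => tI <-; split; first exact: (kP _).1.
  by rewrite (kP _).2; lra.
move=> s t; rewrite !in_itv /= => sI tI.
rewrite [LHS](gdist_edge (kP _).1 (kP _).1) !(kP _).2; try lra.
by congr `|_|; lra.
Qed.

Lemma geodesic_edge_ex u v x y : on_edge u v x -> on_edge u v y ->
  exists S, geodesic (x : X) y S.
Proof.
move=> xe ye; have [le|/ltW le] := leP (x u) (y u).
  by eexists; exact: geodesic_edge xe ye le.
by eexists; exact: geodesic_sym (geodesic_edge ye xe le).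
Qed.

(** Grown one edge at a time from [u]. The control on the weights serves to keep such a geodesic
    away from prescribed vertices. *)
Lemma geodesic_vertex u v : exists2 S, geodesic (#u : X) #v S &
  forall q, S q -> forall w, q w != 0 -> w = v \/ (dn u w < dn u v)%N.
Proof.
move En : (dn u v) => n; elim: n v En => [|n IH] v En.
  exists [set #u]; first by rewrite (dn_eq0 En); apply: geodesic1.
  move=> _ -> w; rewrite -(dn_eq0 En) vertex_pointE.
  by have [->|_ /eqP//] := eqVneq w u; left.
have [w vw wu] : exists2 w, adj v w & dn w u = n.
  by apply: dn_step; rewrite dnC.
rewrite dnC in wu.
have [S gS SP] := IH _ wu.
have wv : adj w v by rewrite adj_sym.
have le : #w v <= #v v by rewrite vertex_pointpp bary_le1.
have ge := geodesic_edge (vertex_on_edger R vw) (vertex_on_edgel R vw) le.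
eexists.
  apply: (geodesic_cat gS ge).
  rewrite [LHS]gdist_vertex [X in X + _]gdist_vertex [X in _ + X]gdist_vertex.
  rewrite En wu -natrD; congr _%:R; rewrite -addn1; congr addn.
  apply/eqP; rewrite eqn_leq dn_adj // andbT lt0n.
  by apply: contraTneq (adj_neq wv) => /dn_eq0 ->; rewrite eqxx.
move=> q [/SP qS|[qe _]] a qa.
  by case: (qS a qa) => [->|an]; right; lia.
have [->|av] := eqVneq a v; [by left|right].
have [->|aw] := eqVneq a w; first by lia.
by case/eqP: qa; apply: qe.2.
Qed.

(** If [#v] is not on the edge of [x], one end of this edge lies between them at no extra cost, and
    a piece of the edge precedes a geodesic between vertices. *)
Lemma geodesic_to_vertex x v : exists S, geodesic (x : X) #v S.
Proof.
case: (point_cases x) => [[u ->]|[a [b [xe _ _]]]].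
  by have [S gS _] := geodesic_vertex u v; exists S.
have aux c d : on_edge c d x -> dist x #c + dist #c #v <= dist x #v ->
    exists S, geodesic (x : X) #v S.
  move=> xcd le; have [S gS _] := geodesic_vertex c v.
  have [T gT] := geodesic_edge_ex xcd (vertex_on_edgel R xcd.1).
  exists (T `|` S); apply: geodesic_cat gT gS _; apply/le_anti.
  by rewrite metric_triangle.
case: (gdist_cut #v xe) => [ye||]; first exact: geodesic_edge_ex xe ye.
  exact: aux xe.
exact: aux (on_edgeC xe).
Qed.

Lemma geodesic_ex x y : exists S, geodesic (x : X) y S.
Proof.
case: (point_cases x) => [[u ->]|[a [b [xe _ _]]]].
  by have [S /geodesic_sym gS] := geodesic_to_vertex y u; exists S.
have aux c d : on_edge c d x -> dist x #c + dist #c y <= dist x y ->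
    exists S, geodesic (x : X) y S.
  move=> xcd le; have [S /geodesic_sym gS] := geodesic_to_vertex y c.
  have [T gT] := geodesic_edge_ex xcd (vertex_on_edgel R xcd.1).
  exists (T `|` S); apply: geodesic_cat gT gS _; apply/le_anti.
  by rewrite metric_triangle.
case: (gdist_cut y xe) => [ye||]; first exact: geodesic_edge_ex xe ye.
  exact: aux xe.
exact: aux (on_edgeC xe).
Qed.

End graph_geodesics.

(** * Graphs with cycles *)

Lemma seq_max (T : eqType) (f : T -> nat) (x : T) (s : seq T) :
  exists2 w, w \in x :: s & forall v, v \in x :: s -> (f v <= f w)%N.
Proof.
elim: s x => [|y s IH] x.
  by exists x => [|v]; rewrite inE // => /eqP ->.
have [w ws wP] := IH y; have [le|lt] := leqP (f x) (f w).
  exists w => [|v]; first by rewrite inE ws orbT.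
  by rewrite inE => /predU1P[->//|/wP].
exists x => [|v]; first by rewrite inE eqxx.
by rewrite inE => /predU1P[->//|/wP vw]; apply: leq_trans vw (ltnW lt).
Qed.

Section not_tree.
Variables (R : realType) (G : graph).
Notation X := (metric_graph R G).
Notation "# v" := (@vertex_point R G v) (at level 2, format "# v").
Implicit Types (u v w a b : G) (x y z p q : gpoint R G).
Local Notation dist := (@gdist R G).

(* Consider a vertex of a cycle at maximal distance from [r]. *)
Lemma not_tree_levels (r : G) : ~ is_tree G ->
  (exists w a b, [/\ adj a w, adj b w, a != b, dn r w = (dn r a).+1
     & dn r w = (dn r b).+1]) \/
  (exists a b, adj a b /\ dn r a = dn r b).
Proof.
move=> /existsNP[c /not_implyP[uc /negP]]; rewrite -leqNgt => c3.
case: c uc c3 => // x s uc c3.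
have [w wc wM] := seq_max (dn r) x s.
(* Once the cycle starts at [w], the neighbours of [w] on it are the first and the last entry of
   [s']; they differ because [s'] has at least two entries and no repetition. *)
case/rot_to: (wc) => i s' rE.
have : ucycle (@adj G) (w :: s').
  by rewrite -rE /ucycle rot_cycle rot_uniq; exact: uc.
have {}wM v : v \in s' -> (dn r v <= dn r w)%N.
  by move=> vs; apply: wM; rewrite -(mem_rot i) rE inE vs orbT.
have : (2 <= size s')%N by rewrite -ltnS -[(size s').+1]/(size (w :: s')) -rE size_rot.
case: s' {rE} wM => // a s'; case/lastP: s' => // s' b wM _.
rewrite /ucycle /= rcons_path last_rcons => /andP[/andP[wa /andP[_ bw]]].
rewrite !inE !mem_rcons !inE !negb_or => /andP[_ /andP[/andP[ab _] _]].
have aw : adj a w by rewrite adj_sym.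
have la := wM a; rewrite inE eqxx in la; have {}la := la isT.
have lb := wM b; rewrite inE mem_rcons inE eqxx orbT in lb; have {}lb := lb isT.
have sa := dn_adjr r wa; have sb := dn_adjr r bw; have sa' := dn_adjr r aw.
have bw' : adj w b by rewrite adj_sym.
have sb' := dn_adjr r bw'.
have [ea|na] := eqVneq (dn r a) (dn r w); first by right; exists a, w.
have [eb|nb] := eqVneq (dn r b) (dn r w); first by right; exists b, w.
by left; exists w, a, b; split=> //; lia.
Qed.

(** Since [x b] is the distance from [a] to [x], the hypothesis on [dist #r x] says that passing
    through [a] is no detour. *)
Lemma geodesic_vertex_edge r a b x S : geodesic (#r : X) #a S -> on_edge a b x ->
  dist #r x = (dn r a)%:R + x b ->
  geodesic (#r : X) x (S `|` [set q | on_edge a b q /\ x a <= q a]).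
Proof.
move=> gS xe dx.
have xa : x a <= #a a by rewrite vertex_pointpp bary_le1.
have gE := geodesic_sym (geodesic_edge xe (vertex_on_edgel R xe.1) xa).
have dE : @mdist R X #r x = @mdist R X #r #a + @mdist R X #a x.
  rewrite [LHS]dx [X in _ = X + _]gdist_vertex [X in _ = _ + X]gdist_sym.
  by rewrite (gdist_vertexl xe).
have := geodesic_cat gS gE dE.
congr (geodesic _ _ (_ `|` _)); apply/seteqP; split=> q /=.
  by case=> qe /andP[].
by case=> qe qa; split=> //; rewrite qa eqxx bary_le1.
Qed.

Lemma not_tree_delta (D : R) : ~ is_tree G -> hyp_const X = D%:E -> 3 / 4 <= D.
Proof.
move=> nt hD; case: (vert_inh G) => r.
(* A bigon is a triangle whose third side is the point [y], which also lies on [B]; a point of [A]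
   far from [B] then bounds the constant from below. *)
suff [x [y [A [B [gA gB]]]]] : exists x y A B, [/\ geodesic (x : X) y A,
    geodesic (x : X) y B & exists2 p, A p & forall q, B q -> 3 / 4 <= dist p q].
  move=> [p Ap H]; apply/ler_addgt0Pr => e e0.
  have [q Bq /ltW] := hyp_const_thin hD gA (geodesic1 (y : X)) gB Ap e0.
  apply: le_trans; apply: H; case: Bq => // ->.
  exact: geodesic_right gB.
case: (not_tree_levels r nt) => [[w [a [b [aw bw ab la lb]]]]|[a [b [ab lab]]]].
  have [A gA AP] := geodesic_vertex R r a.
  have [B gB BP] := geodesic_vertex R r b.
  have gA' := geodesic_vertex_edge gA (vertex_on_edger R aw).
  have gB' := geodesic_vertex_edge gB (vertex_on_edger R bw).
  exists #r, #w; do 2 eexists; split.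
  - by apply: gA'; rewrite gdist_vertex vertex_pointpp la -natr1.
  - by apply: gB'; rewrite gdist_vertex vertex_pointpp lb -natr1.
  (* The weight at [a] is 1-Lipschitz, equals 1 at [#a] and vanishes on the second geodesic, which
     is thus at distance at least 1. *)
  exists #a; first by left; apply: geodesic_right gA.
  move=> q Bq; suff qa : q a = 0.
    have : `|#a a - q a| <= dist #a q by apply: gdist_ge => l; apply: pl_path_lip.
    by rewrite vertex_pointpp qa subr0 normr1; lra.
  case: Bq => [/BP qB|[qe _]].
    apply/eqP; apply: contraT => /qB[/eqP|]; first by rewrite (negPf ab).
    by lia.
  by apply: qe.2 => //; apply: adj_neq.
have ba : adj b a by rewrite adj_sym.
(* Level 0 would force both [a] and [b] to be [r]. *)
have [k ra] : exists k, dn r a = k.+1.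
  case E : (dn r a) => [|k]; last by exists k.
  move: (adj_neq ab); rewrite -(dn_eq0 E) -(dn_eq0 (_ : dn r b = 0%N)) ?eqxx //.
  by rewrite -lab.
have [a' aa' a'r] : exists2 a', adj a a' & dn r a' = k.
  by have [|a' ? ?] := @dn_step _ k a r; rewrite ?[dn a r]dnC //; exists a'; rewrite // dnC.
have a'a : adj a' a by rewrite adj_sym.
have half : 0 <= (1 / 2 : R) <= 1 by lra.
have [m me ma] := edge_point ab half.
have mb : m b = 1 / 2 by have := on_edge_sum me; lra.
have me' := on_edgeC me.
(* With this value the midpoint [m] is reached by geodesics through [a] and through [b]. *)
have dm : dist #r m = k.+1%:R + 1 / 2.
  have hab : dist m #a = 1 / 2 /\ dist m #b = 1 / 2.
    by rewrite (gdist_vertexl me) (gdist_vertexr me).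
  have := gdist_triangle #a #r m; rewrite gdist_vertex ra (gdist_sym #a) hab.1.
  rewrite gdist_sym => le; apply/le_anti; rewrite le /=.
  case: (gdist_cut #r me) => [[_ re]||]; last 2 first.
  - by rewrite gdist_vertex hab.1 dnC ra; lra.
  - by rewrite gdist_vertex hab.2 dnC -lab ra; lra.
  have : #r r = 1 :> R by rewrite vertex_pointpp.
  rewrite re; first lra.
    by apply: contra_eq_neq ra => <-; rewrite dnn.
  by rewrite lab in ra; apply: contra_eq_neq ra => <-; rewrite dnn.
have [A gA AP] := geodesic_vertex R r a'.
have [B gB BP] := geodesic_vertex R r b.
have gA' := geodesic_vertex_edge gA (vertex_on_edger R a'a).
have {}gA' := gA' _; rewrite gdist_vertex vertex_pointpp a'r ra -natr1 in gA'.
have gA2 := geodesic_vertex_edge (gA' erefl) me.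
have gB' := geodesic_vertex_edge gB me'.
exists #r, m; do 2 eexists; split.
- by apply: gA2; rewrite dm ra mb.
- by apply: gB'; rewrite dm -lab ra ma.
have quart : 0 <= (3 / 4 : R) <= 1 by lra.
have [p pe pa] := edge_point aa' quart.
have pa' : p a' = 1 / 4 by have := on_edge_sum pe; lra.
exists p.
  left; right; split; first exact: on_edgeC.
  by rewrite vertex_pointpn ?bary_ge0 // adj_neq.
have nba' : b != a' by apply: contra_eq_neq lab => ->; rewrite ra a'r; lia.
have nba : b != a := adj_neq ba.
have dpa : dist p #a = 1 / 4 by rewrite (gdist_vertexl pe).
have dpa' : dist p #a' = 3 / 4 by rewrite (gdist_vertexr pe).
(* On [B] the weight at [a] vanishes, whereas it is 3/4 at [p]. To the half edge from [b] to [m], a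
   path from [p] either goes through [a], with length at least 1/4 + 1/2, or first runs 3/4 to
   [a']. *)
move=> q [/BP qB|[qe qb]].
  have qa : q a = 0.
    apply/eqP; apply: contraT => /qB[/eqP|]; first by rewrite (negPf (adj_neq ab)).
    by rewrite lab ltnn.
  have : `|p a - q a| <= dist p q by apply: gdist_ge => l; apply: pl_path_lip.
  by rewrite pa qa subr0 ger0_norm; lra.
rewrite mb in qb.
case: (gdist_cut q pe) => [[_ qe']||].
- by have := qe' b nba nba'; lra.
- by rewrite dpa gdist_sym (gdist_vertexr qe); lra.
by have := gdist_ge0 #a' q; lra.
Qed.

End not_tree.

(** * Trees *)

Section real_lemmas.
Variable R : realType.

Lemma opposite_sides (c s u v : R) : 0 < s -> `|c - u| = s -> `|c - v| = s ->
  `|u - v| = 2 * s -> u < c < v \/ v < c < u.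
Proof.
move=> s0; have [?|?] := ler0P (c - u); have [?|?] := ler0P (c - v);
  have [?|?] := ler0P (u - v) => *; by [left; lra|right; lra].
Qed.

(** The expression clamps [r] to [[s, t]]; it extends a path given on an interval to a continuous
    one on the whole line. *)
Lemma max_min_lipschitz (s t r r' : R) : s <= t ->
  `|Num.max s (Num.min r t) - Num.max s (Num.min r' t)| <= `|r - r'|.
Proof.
move=> st.
have n1 := ler_norm (r - r'); have n2 := ler_norm (r' - r); rewrite distrC in n2.
rewrite ler_norml; case: (leP r t) => ?; case: (leP r' t) => ?;
  rewrite ?(max_idPr st); case: (leP s r) => ?; case: (leP s r') => ?; lra.
Qed.

End real_lemmas.

Section trees.
Variables (R : realType) (G : graph).
Hypothesis treeG : is_tree G.
Notation X := (metric_graph R G).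
Notation "# v" := (@vertex_point R G v) (at level 2, format "# v").
Implicit Types (u v w a b : G) (x y z p q : gpoint R G).
Local Notation dist := (@gdist R G).

(** * Separation of a tree by an edge *)

Definition off_edge a b : rel G := [rel u v |
  adj u v && ~~ ((u == a) && (v == b) || (u == b) && (v == a))].

Definition off_conn a b u v := exists2 p, path (off_edge a b) u p & v = last u p.

Lemma off_edge_sym a b : symmetric (off_edge a b).
Proof.
move=> u v; rewrite /off_edge /= adj_sym; congr (_ && ~~ _).
by rewrite orbC ![(v == _) && _]andbC.
Qed.

Lemma off_conn_trans a b u v w :
  off_conn a b u v -> off_conn a b v w -> off_conn a b u w.
Proof.
move=> [p pP ->] [q qP ->]; exists (p ++ q); last by rewrite last_cat.
by rewrite cat_path pP.
Qed.

Lemma off_conn_sym a b u v : off_conn a b u v -> off_conn a b v u.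
Proof.
move=> [p pP ->]; exists (rev (belast u p)).
  rewrite rev_path (eq_path (e' := off_edge a b)) // => x y.
  by rewrite off_edge_sym.
by case: p {pP} => //= w p; rewrite rev_cons last_rcons.
Qed.

(** A path avoiding the edge, once made free of repetitions, would close up with it to a cycle. *)
Lemma tree_cut a b : adj a b -> ~ off_conn a b a b.
Proof.
move=> ab [p pP bE].
case/shortenP: pP bE => p' pP up _ bE.
have : (size (a :: p') < 3)%N.
  apply: treeG; rewrite /ucycle up andbT /= rcons_path -bE adj_sym ab andbT.
  by apply: sub_path pP => u v /andP[].
case: p' pP bE {up} => [|c [|//]] /=.
  by move=> _ E; move: ab; rewrite E adj_irr.
by rewrite andbT => acP E _; move: acP; rewrite -E /off_edge /= !eqxx andbF.
Qed.

(** A shortest walk to [a] preserves the inequality, so it never leaves from [b] and never crosses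
    the edge. *)
Lemma off_conn_closer a b v : adj a b -> (dn v a <= dn v b)%N -> off_conn a b v a.
Proof.
move=> ab; move En : (dn v a) => n; elim: n v En => [|n IH] v En le.
  by rewrite (dn_eq0 En); exists [::].
have [w vw wa] := dn_step En.
have wb : (n <= dn w b)%N by have := dn_adjl b vw; lia.
have wP := IH w wa wb.
apply: off_conn_trans wP; exists [:: w] => //=; rewrite /off_edge /= vw andbT /=.
apply/negP => /orP[/andP[/eqP va _]|/andP[/eqP vb _]].
  by rewrite va dnn in En.
by rewrite vb dnn in le.
Qed.

Lemma off_conn_further a b v : adj a b -> (dn v b <= dn v a)%N -> off_conn a b v b.
Proof.
move=> ab le; have ba : adj b a by rewrite adj_sym.
have [p pP pl] := off_conn_closer ba le; exists p => //.
by apply: sub_path pP => u w; rewrite /off_edge /= orbC.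
Qed.

(** For an edge of a tree, the value is -1 beyond [a], 1 beyond [b], and it parametrizes the edge
    affinely in between. *)
Definition side a b q := dist q #a - dist q #b.

(** Equal distances to [a] and [b] would connect both to [v], hence to each other, without the
    edge. *)
Lemma side_vertex a b v : adj a b ->
  (dn v a).+1 = dn v b /\ side a b #v = - 1 \/
  (dn v b).+1 = dn v a /\ side a b #v = 1.
Proof.
move=> ab; have ba : adj b a by rewrite adj_sym.
have l1 := dn_adjr v ab; have l2 := dn_adjr v ba.
rewrite /side !gdist_vertex.
have nE : dn v a <> dn v b.
  move=> E; apply: (tree_cut ab).
  apply: (@off_conn_trans _ _ _ v); first apply: off_conn_sym.
    by apply: off_conn_closer; rewrite ?E.
  by apply: off_conn_further; rewrite ?E.
have [E|E] : (dn v a).+1 = dn v b \/ (dn v b).+1 = dn v a by lia.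
  by left; split=> //; rewrite -E -natr1; lra.
by right; split=> //; rewrite -E -natr1; lra.
Qed.

Lemma side_adj a b u v : adj a b -> adj u v ->
  ~ (u = a /\ v = b) -> ~ (u = b /\ v = a) ->
  side a b #u = side a b #v.
Proof.
move=> ab uv n1 n2.
have uvo : off_conn a b u v.
  exists [:: v] => //=; rewrite /off_edge /= uv andbT /=.
  by apply/negP => /orP[/andP[/eqP ? /eqP ?]|/andP[/eqP ? /eqP ?]]; tauto.
case: (side_vertex u ab) => -[uE ->]; case: (side_vertex v ab) => -[vE ->] //.
  case: (tree_cut ab); apply: (@off_conn_trans _ _ _ u).
    by apply/off_conn_sym/off_conn_closer => //; lia.
  by apply: off_conn_trans uvo _; apply: off_conn_further => //; lia.
case: (tree_cut ab); apply: (@off_conn_trans _ _ _ v).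
  by apply/off_conn_sym/off_conn_closer => //; lia.
by apply: off_conn_trans (off_conn_sym uvo) _; apply: off_conn_further => //; lia.
Qed.

Lemma side_on_edge a b q : on_edge a b q -> side a b q = q b - q a.
Proof. by move=> qe; rewrite /side (gdist_vertexl qe) (gdist_vertexr qe). Qed.

Lemma gdist_vertex_cut u v q w : on_edge u v q ->
  dist q #w = dist q #u + dist #u #w \/ dist q #w = dist q #v + dist #v #w.
Proof.
move=> qe; have t1 := gdist_triangle #u q #w; have t2 := gdist_triangle #v q #w.
case: (gdist_cut #w qe) => [we|le|le]; last 2 first.
- by left; apply/le_anti; rewrite t1 le.
- by right; apply/le_anti; rewrite t2 le.
have : (w == u) || (w == v).
  apply/negPn; rewrite negb_or; apply/negP => /andP[wu wv].
  by have := we.2 w wu wv; rewrite vertex_pointpp; lra.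
by case/orP => /eqP ->; [left|right]; rewrite gdistxx addr0.
Qed.

(** The ends of the edge of [q] are on the same side, so their distances to [a] and to [b] differ by
    the same constant, which survives in the minimum over both ends. *)
Lemma side_off_edge a b q : adj a b -> ~ on_edge a b q ->
  side a b q = 1 \/ side a b q = - 1.
Proof.
move=> ab nqe; case: (point_cases q) => [[v ->]|[u [v [qe _ _]]]].
  by case: (side_vertex v ab) => -[_ ->]; [right|left].
have sE : side a b #u = side a b #v.
  by apply: side_adj qe.1 _ _ => // -[uE vE]; apply: nqe; rewrite uE vE in qe;
    [exact: qe|exact: on_edgeC].
have ta1 := gdist_triangle #u q #a; have ta2 := gdist_triangle #v q #a.
have tb1 := gdist_triangle #u q #b; have tb2 := gdist_triangle #v q #b.
have ca := gdist_vertex_cut a qe; have cb := gdist_vertex_cut b qe.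
case: (side_vertex u ab) sE => -[_ uE]; rewrite uE; move: uE; rewrite /side.
  by move=> uE vE; right; case: ca cb => ? [] ?; lra.
by move=> uE vE; left; case: ca cb => ? [] ?; lra.
Qed.

Lemma side_inj a b p q : on_edge a b p -> 0 < p a -> 0 < p b ->
  side a b q = side a b p -> q = p.
Proof.
move=> pe pa pb; have ps := on_edge_sum pe; rewrite (side_on_edge pe).
have [qe|nqe] := pselect (on_edge a b q); last first.
  by case: (side_off_edge pe.1 nqe) => -> ?; exfalso; lra.
rewrite (side_on_edge qe) => E; apply: (on_edge_eq qe pe).
by have := on_edge_sum qe; lra.
Qed.

Lemma side_lipschitz a b p q : `|side a b p - side a b q| <= 2 * dist p q.
Proof.
rewrite /side.
have t1 := gdist_triangle p q #a; have t2 := gdist_triangle q p #a.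
have t3 := gdist_triangle p q #b; have t4 := gdist_triangle q p #b.
rewrite (gdist_sym q p) in t1 t2 t3 t4.
rewrite ler_norml; lra.
Qed.

Lemma side_ivt a b (s t : R) (g : R -> X) (c : R) : s <= t -> iso_on s t g ->
  (side a b (g s) <= c <= side a b (g t)) || (side a b (g t) <= c <= side a b (g s)) ->
  exists2 r, s <= r <= t & side a b (g r) = c.
Proof.
move=> st giso cI.
(* Outside [[s, t]] the path is frozen at its ends, which makes [f] continuous everywhere. *)
pose f r := side a b (g (Num.max s (Num.min r t))).
have fE r : s <= r <= t -> f r = side a b (g r).
  by move=> /andP[sr rt]; rewrite /f (min_idPl rt) (max_idPr sr).
have fc : continuous f.
  move=> r; apply/cvgrPdist_le => e e0; near=> r'.
  apply: le_trans (side_lipschitz _ _ _ _) _.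
  have H k : s <= Num.max s (Num.min k t) <= t.
    by rewrite le_max lexx ge_max st ge_min lexx orbT.
  rewrite [dist _ _]giso ?in_itv /= ?H //.
  have : `|r - r'| <= e / 2.
    near: r'; apply: nbhs_norm_le_nbhs.
    by exists (e / 2) => [|z /ltW //]; rewrite /= divr_gt0.
  by have := max_min_lipschitz r r' st; lra.
have [||r] := @IVT R f s t c st.
- exact: continuous_subspaceT.
- rewrite !fE ?lexx ?st //.
  by rewrite ge_min le_max; case/orP: cI => /andP[-> ->]; rewrite ?orbT.
by rewrite in_itv /= => rI; rewrite fE // => E; exists r.
Unshelve. all: by end_near.
Qed.

Lemma geodesic_cross a b x y S p : on_edge a b p -> 0 < p a -> 0 < p b ->
  geodesic (x : X) y S ->
  (side a b x <= side a b p <= side a b y) || (side a b y <= side a b p <= side a b x) ->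
  S p.
Proof.
move=> pe pa pb [L [g [L0 <- <- -> giso]]] /(side_ivt L0 giso)[r rI /(side_inj pe pa pb) <-].
by exists r.
Qed.

(** Along the first side, [side a b] passes from one side of its value at [p] to the other; wherever
    its value at [z] lies, one of the two other sides takes the value of [p] too, hence contains
    [p]. *)
Lemma tree_triangle_interior a b x y z A B C p : on_edge a b p -> 0 < p a -> 0 < p b ->
  geodesic (x : X) y A -> geodesic (y : X) z B -> geodesic (x : X) z C ->
  A p -> p != x -> p != y -> (B `|` C) p.
Proof.
move=> pe pa pb [L [g [L0 gx gy -> giso]]] gB gC [t0]; rewrite /= in_itv /= => tI gt.
move=> /eqP px /eqP py.
have t00 : 0 < t0.
  rewrite lt_def andbC; case/andP: tI => -> _ /=.
  by apply/eqP => t00; apply: px; rewrite -gx -gt t00.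
have t0L : t0 < L.
  rewrite lt_def andbC; case/andP: tI => _ -> /=.
  by apply/eqP => t0L; apply: py; rewrite -gy -gt t0L.
set c := side a b p.
(* Away from [t0] the comparison with [c] cannot change, since [g] would meet [p] a second time. *)
have F_const s t : 0 <= s -> s <= t -> t <= L -> (t < t0) || (t0 < s) ->
    (side a b (g s) < c) = (side a b (g t) < c).
  move=> s0 st tL nt; have gi : iso_on s t g.
    by move=> i j; rewrite !in_itv /= => iI jI; apply: giso; rewrite in_itv /=; lra.
  apply/idP/idP => lt; rewrite ltNge; apply/negP => le;
    have [|r rI /(side_inj pe pa pb) rE] := @side_ivt a b s t g c st gi.
  - by rewrite le (ltW lt).
  - have : @mdist R X (g r) (g t0) = 0 by rewrite gt rE mdistxx.
    rewrite giso ?in_itv /=; try lra.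
    by move/normr0P/eqP => ?; lra.
  - by rewrite le (ltW lt) orbT.
  have : @mdist R X (g r) (g t0) = 0 by rewrite gt rE mdistxx.
  rewrite giso ?in_itv /=; try lra.
  by move/normr0P/eqP => ?; lra.
(* Shorter than the distances from [p] to both ends of the edge, [s] keeps [g (t0 - s)] and
   [g (t0 + s)] on it; being [2 * s] apart, they lie on opposite sides of [p]. *)
have [s [s0 st sL sa sb]] : exists s, [/\ 0 < s, s <= t0, s <= L - t0, s < p a & s < p b].
  exists (Num.min (Num.min t0 (L - t0)) (Num.min (p a / 2) (p b / 2))).
  have h1 : p a / 2 < p a by lra.
  have h2 : p b / 2 < p b by lra.
  split; rewrite ?lt_min ?ge_min ?gt_min ?lexx ?h1 ?h2 ?orbT //.
  by rewrite t00 subr_gt0 t0L !divr_gt0.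
have near r : `|t0 - r| = s -> 0 <= r <= L -> on_edge a b (g r).
  move=> rs rI; have dr : dist p (g r) = s.
    by rewrite -gt -rs; apply: giso; rewrite in_itv /=; lra.
  case: (gdist_cut (g r) pe) => //; rewrite dr (gdist_vertexl pe, gdist_vertexr pe).
    by have := gdist_ge0 #a (g r); lra.
  by have := gdist_ge0 #b (g r); lra.
have e1 : on_edge a b (g (t0 - s)) by apply: near; [rewrite ger0_norm; lra|lra].
have e2 : on_edge a b (g (t0 + s)) by apply: near; [rewrite ler0_norm; lra|lra].
have d1 : `|p a - g (t0 - s) a| = s.
  rewrite -(gdist_edge pe e1) -gt [LHS]giso ?in_itv /=; try lra.
  by rewrite ger0_norm; lra.
have d2 : `|p a - g (t0 + s) a| = s.
  rewrite -(gdist_edge pe e2) -gt [LHS]giso ?in_itv /=; try lra.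
  by rewrite ler0_norm; lra.
have d3 : `|g (t0 - s) a - g (t0 + s) a| = 2 * s.
  rewrite -(gdist_edge e1 e2) [LHS]giso ?in_itv /=; try lra.
  by rewrite ler0_norm; lra.
have [s1 s2] : side a b (g (t0 - s)) = 1 - 2 * g (t0 - s) a /\
    side a b (g (t0 + s)) = 1 - 2 * g (t0 + s) a.
  by rewrite !side_on_edge //; have := on_edge_sum e1; have := on_edge_sum e2; lra.
have cE : c = 1 - 2 * p a by rewrite /c side_on_edge //; have := on_edge_sum pe; lra.
have Ex : (side a b x < c) = (side a b (g (t0 - s)) < c).
  by rewrite -gx; apply: F_const; lra.
have Ey : (side a b y < c) = (side a b (g (t0 + s)) < c).
  by rewrite -gy; symmetry; apply: F_const; lra.
have opp : side a b x < c <= side a b y \/ side a b y < c <= side a b x.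
  rewrite ![c <= _]leNgt Ex Ey s1 s2 cE -!leNgt.
  by have [?|?] := opposite_sides s0 d1 d2 d3; [right|left]; lra.
have crossB := geodesic_cross pe pa pb gB; have crossC := geodesic_cross pe pa pb gC.
rewrite -/c in crossB crossC.
have [zc|/ltW zc] := leP (side a b z) c; case: opp => /andP[/ltW h1 h2].
- by left; apply: crossB; rewrite zc h2 orbT.
- by right; apply: crossC; rewrite zc h2 orbT.
- by right; apply: crossC; rewrite h1 zc.
- by left; apply: crossB; rewrite h1 zc.
Qed.

Lemma tree_delta : hyp_const X = 0%E.
Proof.
apply/le_anti/andP; split; last first.
  by case: (vert_inh G) => v; apply: hyp_const_ge0; exact: #v.
apply: hyp_const_le => // x y z A B C gA gB gC p Ap e e0.
have [px|/eqP px] := eqVneq p x.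
  by exists x; [right; apply: geodesic_left gC|rewrite px mdistxx add0r].
have [py|/eqP py] := eqVneq p y.
  by exists y; [left; apply: geodesic_left gB|rewrite py mdistxx add0r].
(* A vertex [p] is replaced by a nearby interior point of an edge on the same side of the
   triangle. *)
have [q [Aq [dq [qx [qy [a [b [qe qa qb]]]]]]]] :
    exists q, A q /\ dist p q < e /\ q != x /\ q != y /\
      exists a b, [/\ on_edge a b q, 0 < q a & 0 < q b].
  case: (point_cases p) => [[v pv]|pI]; last first.
    by exists p; rewrite gdistxx; split=> //; split=> //; split; [|split=> //]; apply/eqP.
  move: (gA) Ap => [L [g [L0 gx gy -> giso]]] [t]; rewrite /= in_itv /= => tI gt.
  have tL : t < L.
    rewrite lt_def andbC; case/andP: tI => _ -> /=.
    by apply/eqP => tL; apply: py; rewrite -gy -gt tL.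
  (* Distances between vertices are integers, so [0 < s < 1] ensures that [g (t + s)] is not a
     vertex. *)
  have [s [s0 s1 se sL]] : exists s, [/\ 0 < s, s < 1, s < e & s < L - t].
    exists (Num.min (1 / 2) (Num.min (e / 2) ((L - t) / 2))).
    have h0 : 1 / 2 < 1 :> R by lra.
    have h1 : e / 2 < e by lra.
    have h2 : (L - t) / 2 < L - t by lra.
    split; rewrite ?lt_min ?gt_min ?h0 ?h1 ?h2 ?orbT //.
    by rewrite !divr_gt0 // subr_gt0.
  have dd r : 0 <= r <= L -> dist (g (t + s)) (g r) = `|t + s - r|.
    by move=> rI; apply: giso; rewrite in_itv /=; lra.
  exists (g (t + s)); split; first by exists (t + s); rewrite //= in_itv /=; lra.
  have dp : dist (g (t + s)) p = s by rewrite -gt dd // ger0_norm; lra.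
  split; first by rewrite gdist_sym dp.
  split; first by apply/eqP => E; have := dd 0; rewrite gx -E gdistxx ger0_norm; lra.
  split; first by apply/eqP => E; have := dd L; rewrite gy -E gdistxx ler0_norm; lra.
  case: (point_cases (g (t + s))) => // -[w wE].
  move: dp; rewrite wE pv gdist_vertex => dp; exfalso.
  have : (0 < dn w v)%N by rewrite -(ltr_nat R) dp.
  by rewrite -(ler_nat R) dp; lra.
by exists q; rewrite ?add0r //; exact: tree_triangle_interior qe qa qb gA gB gC Aq qx qy.
Qed.

End trees.

(** Fibres being single vertices, the first projection maps cycles injectively to cycles of [G1]. *)
Lemma trivial_lex_tree (G1 G2 : graph) : is_tree G1 -> trivial_graph G2 ->
  is_tree (lex_product G1 G2).
Proof.
move=> t1 [v0 v0P] c /andP[cc cu].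
have step (e f : lex_product G1 G2) : adj e f -> adj e.1 f.1.
  by case/orP=> // /andP[_]; rewrite (v0P e.2) (v0P f.2) adj_irr.
rewrite -(size_map fst); apply: t1; apply/andP; split; last first.
  rewrite map_inj_uniq // => -[a a2] [b b2] /= ->.
  by rewrite (v0P a2) (v0P b2).
case: c cc {cu} => //= x s; rewrite -map_rcons.
move: (rcons s x) => p.
by elim: p x {s} => //= y p IH x /andP[/step -> /IH ->].
Qed.

(** * Lexicographic products *)

Section product.
Variables (R : realType) (G1 G2 : graph).
Hypothesis G1_nbr : forall u : G1, exists v, adj u v.
Notation G := (lex_product G1 G2).
Notation X := (metric_graph R G).
Notation X1 := (metric_graph R G1).
Notation "# v" := (@vertex_point R _ v) (at level 2, format "# v").
Implicit Types (u v w a b e f : G) (x y z p q : gpoint R G).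
Local Notation dist := (@gdist R G).
Local Notation dist1 := (@gdist R G1).

Lemma lex_horizontal u v : adj u.1 v.1 -> adj u v.
Proof. by move=> uv; rewrite /= /lex_adj uv. Qed.

(** The conditions bear on all edges containing [x] at once, because a vertex lies on many:
    horizontal edges map isometrically, vertical ones collapse. *)
Definition proj_rel x (y : gpoint R G1) := forall u v, on_edge u v x ->
  (adj u.1 v.1 -> on_edge u.1 v.1 y /\ y u.1 = x u) /\ (u.1 = v.1 -> y = #u.1).

Lemma proj_rel_vertex e : proj_rel #e #e.1.
Proof.
move=> u v xe; have : (e == u) || (e == v).
  apply/negPn; rewrite negb_or; apply/negP => /andP[ua ub].
  by have := xe.2 e ua ub; rewrite vertex_pointpp; lra.
case/orP => /eqP E; subst e; split=> [uv|->] //.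
- by split; [exact: vertex_on_edgel|rewrite !vertex_pointpp].
- split; first exact: vertex_on_edger.
  by rewrite !vertex_pointpn ?adj_neq //; exact: lex_horizontal.
Qed.

Lemma proj_ex x : exists y : gpoint R G1, proj_rel x y.
Proof.
case: (point_cases x) => [[u ->]|[u [v [xe xu xv]]]].
  by exists #u.1; exact: proj_rel_vertex.
have key a b : on_edge a b x -> (a = u /\ b = v) \/ (a = v /\ b = u).
  move=> xab; case: (on_edge_cases xe xab) => // E.
    by move: xv; rewrite E vertex_pointpn ?ltxx // eq_sym adj_neq ?xe.1.
  by move: xu; rewrite E vertex_pointpn ?ltxx // adj_neq ?xe.1.
have [uv|/negP nuv] := boolP (adj u.1 v.1).
  have [|y ye yu] := @edge_point R _ _ _ (x u) uv; first by rewrite bary_ge0 bary_le1.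
  exists y => a b /key[[-> ->]|[-> ->]]; split=> // E.
  - by move: (adj_neq uv); rewrite E eqxx.
  - split; first exact: on_edgeC.
    by have := on_edge_sum ye; have := on_edge_sum xe; lra.
  - by move: (adj_neq uv); rewrite E eqxx.
have uv : u.1 = v.1 by case/orP: xe.1 => [//|/andP[/eqP]].
exists #u.1 => a b /key[[-> ->]|[-> ->]]; split=> // [|]; first by rewrite adj_sym.
by rewrite uv.
Qed.

Definition proj x : gpoint R G1 := projT1 (cid (proj_ex x)).

Lemma projP x : proj_rel x (proj x).
Proof. exact: (projT2 (cid (proj_ex x))). Qed.

Lemma proj_hor u v x : on_edge u v x -> adj u.1 v.1 -> on_edge u.1 v.1 (proj x).
Proof. by move=> /projP[H _] /H[]. Qed.

Lemma proj_horE u v x : on_edge u v x -> adj u.1 v.1 -> proj x u.1 = x u.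
Proof. by move=> /projP[H _] /H[]. Qed.

Lemma proj_ver u v x : on_edge u v x -> u.1 = v.1 -> proj x = #u.1.
Proof. by move=> /projP[_]. Qed.

Lemma proj_vertex e : proj #e = #e.1.
Proof.
have [c uc] := G1_nbr e.1; pose f : G := (c, e.2).
have ef : adj e f by exact: lex_horizontal.
have H := vertex_on_edgel R ef.
by apply: bary1; rewrite (proj_horE H uc) vertex_pointpp.
Qed.

Lemma proj_lipschitz x y : dist1 (proj x) (proj y) <= dist x y.
Proof.
apply: gdist_ge => l; elim=> {x y l} [x|a b x y z l xe ye _ IH]; first by rewrite gdistxx.
apply: le_trans (gdist_triangle (proj y) _ _) _; apply: lerD => //.
case/orP: (xe.1) => [ab|/andP[/eqP ab _]].
  by rewrite (gdist_edge (proj_hor xe ab) (proj_hor ye ab)) !(proj_horE _ ab).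
by rewrite (proj_ver xe ab) (proj_ver ye ab) gdistxx.
Qed.

(** A walk of [G1] lifts with second coordinate [f.2] from its first step on, since horizontal edges
    ignore second coordinates; it has a first step because the fibres differ. *)
Lemma dn_lex_neq e f : e.1 != f.1 -> (dn e f <= dn e.1 f.1)%N.
Proof.
move=> nef; have [[|c p] [pP pl ps]] := dn_walk e.1 f.1.
  by rewrite /= in pl; rewrite pl eqxx in nef.
rewrite -ps; apply: dn_le; exists [seq (i, f.2) : G | i <- c :: p].
split; last by rewrite size_map.
  move: pP => /= /andP[ec cp]; apply/andP; split; first exact: lex_horizontal.
  elim: p c cp {pl ps ec} => //= d p IH c /andP[cd /IH ->].
  by rewrite /lex_adj /= cd.
by rewrite /= (last_map (fun i => (i, f.2))) /= in pl *; rewrite pl -surjective_pairing.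
Qed.

(** * Distances between points of horizontal edges *)

Definition horizontal x := exists u v, on_edge u v x /\ adj u.1 v.1.

Lemma horizontal_vertex e : horizontal #e.
Proof.
have [c uc] := G1_nbr e.1; exists e, (c, e.2); split=> //; apply: vertex_on_edgel.
exact: lex_horizontal.
Qed.

Lemma dist_vertex_vertex e f : e.1 <> f.1 -> dist #e #f <= dist1 (proj #e) (proj #f).
Proof.
by move=> /eqP ef; rewrite !proj_vertex !gdist_vertex ler_nat dn_lex_neq.
Qed.

(** A shortest path from [proj y] to [#e.1] leaves the edge through [u.1] or [v.1], and the
    remaining distance between vertices of distinct fibres lifts. *)
Lemma dist_vertex_far e u v y : on_edge u v y -> adj u.1 v.1 ->
  e.1 <> u.1 -> e.1 <> v.1 -> dist y #e <= dist1 (proj y) (proj #e).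
Proof.
move=> ye uv eu ev; have py := proj_hor ye uv.
have tu := gdist_triangle #u y #e; have tv := gdist_triangle #v y #e.
have du : dist #u #e <= dist1 #u.1 #e.1.
  by rewrite -!proj_vertex dist_vertex_vertex // => /esym.
have dv : dist #v #e <= dist1 #v.1 #e.1.
  by rewrite -!proj_vertex dist_vertex_vertex // => /esym.
have eyu : dist y #u = dist1 (proj y) #u.1.
  rewrite (gdist_vertexl ye) (gdist_vertexl py).
  by have := on_edge_sum ye; have := on_edge_sum py; rewrite (proj_horE ye uv); lra.
have eyv : dist y #v = dist1 (proj y) #v.1.
  by rewrite (gdist_vertexr ye) (gdist_vertexr py) (proj_horE ye uv).
rewrite [in leRHS]proj_vertex.
case: (gdist_cut #e.1 py) => [[_ H]||]; try lra.
have := H e.1; rewrite vertex_pointpp.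
have -> : e.1 != u.1 by apply/eqP.
have -> : e.1 != v.1 by apply/eqP.
by move=> /(_ isT isT); lra.
Qed.

Lemma dist1_on_edge (a b : G1) (x y : gpoint R G1) :
  on_edge a b x -> on_edge a b y -> dist1 x y <= 1.
Proof.
move=> xe ye; rewrite (gdist_edge xe ye).
have := bary_ge0 x a; have := bary_ge0 y a; have := bary_le1 x a; have := bary_le1 y a.
by move=> ? ? ? ?; rewrite ler_norml; lra.
Qed.

Lemma dist_vertex_horizontal e y : horizontal y ->
  dist y #e <= dist1 (proj y) (proj #e) \/ dist1 (proj y) (proj #e) <= 1.
Proof.
move=> [u [v [ye uv]]]; have py := proj_hor ye uv; rewrite [in X in _ \/ X]proj_vertex.
have [->|/eqP eu] := eqVneq e.1 u.1.
  by right; apply: dist1_on_edge py (vertex_on_edgel _ _).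
have [->|/eqP ev] := eqVneq e.1 v.1.
  by right; apply: dist1_on_edge py (vertex_on_edger _ _).
by left; exact: dist_vertex_far ye uv eu ev.
Qed.

(** As [u] is adjacent to [b] and [v] to [a], there are routes through [u, b] and through [v, a];
    their lengths are at most 4 in total, so one is at most 2. *)
Lemma dist_horizontal_meet u v a b x y : on_edge u v x -> adj u.1 v.1 ->
  on_edge a b y -> adj a.1 b.1 -> u.1 = a.1 ->
  dist x y <= 2 /\ dist1 (proj x) (proj y) <= 2.
Proof.
move=> xe uv ye ab ua.
have px := proj_hor xe uv; have py := proj_hor ye ab; split; last first.
  apply: le_trans (gdist_triangle #u.1 _ _) _.
  have h1 := dist1_on_edge px (vertex_on_edgel R uv).
  have h2 : dist1 #u.1 (proj y) <= 1.
    by rewrite ua; apply: dist1_on_edge (vertex_on_edgel R ab) py.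
  lra.
have adist e f : adj e f -> dist #e #f <= 1.
  by move=> ef; rewrite gdist_vertex (ler_nat _ _ 1) dn_adj.
have ub : adj u b by apply: lex_horizontal; rewrite ua.
have av : adj v a by apply: lex_horizontal; rewrite -ua adj_sym.
have h1 := gdist_triangle #u x y; have h2 := gdist_triangle #b #u y.
have h3 := gdist_triangle #v x y; have h4 := gdist_triangle #a #v y.
have := adist _ _ ub; have := adist _ _ av.
have := on_edge_sum xe; have := on_edge_sum ye.
move: h1 h2 h3 h4; rewrite ![dist _ y]gdist_sym.
rewrite (gdist_vertexl xe) (gdist_vertexr xe) (gdist_vertexl ye) (gdist_vertexr ye).
lra.
Qed.

Lemma dist_horizontal x y : horizontal x -> horizontal y ->
  dist x y <= dist1 (proj x) (proj y) \/
  dist x y <= 2 /\ dist1 (proj x) (proj y) <= 2.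
Proof.
move=> [u [v [xe uv]]] [a [b [ye ab]]].
have xe' := on_edgeC xe; have ye' := on_edgeC ye.
have vu : adj v.1 u.1 by rewrite adj_sym.
have ba : adj b.1 a.1 by rewrite adj_sym.
have [E|/eqP ua] := eqVneq u.1 a.1.
  by right; exact: dist_horizontal_meet xe uv ye ab E.
have [E|/eqP ub] := eqVneq u.1 b.1.
  by right; exact: dist_horizontal_meet xe uv ye' ba E.
have [E|/eqP va] := eqVneq v.1 a.1.
  by right; exact: dist_horizontal_meet xe' vu ye ab E.
have [E|/eqP vb] := eqVneq v.1 b.1.
  by right; exact: dist_horizontal_meet xe' vu ye' ba E.
left; have px := proj_hor xe uv; have py := proj_hor ye ab.
have fu := dist_vertex_far ye ab ua ub; have fv := dist_vertex_far ye ab va vb.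
rewrite !proj_vertex ![dist1 (proj y) _]gdist_sym ![dist y _]gdist_sym in fu fv.
have eu : dist x #u = dist1 (proj x) #u.1.
  rewrite (gdist_vertexl xe) (gdist_vertexl px).
  by have := on_edge_sum xe; have := on_edge_sum px; rewrite (proj_horE xe uv); lra.
have ev : dist x #v = dist1 (proj x) #v.1.
  by rewrite (gdist_vertexr xe) (gdist_vertexr px) (proj_horE xe uv).
have tu := gdist_triangle #u x y; have tv := gdist_triangle #v x y.
case: (gdist_cut (proj y) px) => [pxy||]; try lra.
(* A projection of [y] on the edge of [proj x] would give the two edges a common fibre. *)
exfalso; case: (on_edge_cases pxy py) => [E|E|[[/esym ? _]|[/esym ? _]]] //.
  by have := py.2 u.1; rewrite E vertex_pointpp; case: eqVneq => // _;
    case: eqVneq => // _ /(_ isT isT); lra.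
by have := py.2 v.1; rewrite E vertex_pointpp; case: eqVneq => // _;
    case: eqVneq => // _ /(_ isT isT); lra.
Qed.

(* [h] is the distance of [x] to its closest vertex [c] when [x] lies inside a
   vertical edge. If [proj] shortens the distance of [x] and [y], then their
   projections lie within [k] of a common vertex, with the [k] of [x] and [y]
   respectively: a vertical edge projects onto that vertex. *)
Definition fiber_data x (d : R * R * gpoint R G) :=
  let: (h, k, c) := d in
  [/\ dist x c <= h, proj c = proj x, horizontal c,
      forall y, dist x y <= h -> proj y = proj x &
      [/\ h = 0, k = 1 & horizontal x] \/
      [/\ 0 < h, h <= 1 / 2, k = 0, ~ horizontal x & exists e, c = #e]].

Lemma fiber_data_ex x : exists d, fiber_data x d.
Proof.
have [hx|nhx] := pselect (horizontal x).
  exists (0, 1, x); split=> //; rewrite ?gdistxx //; last by left.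
  move=> y d0; suff -> : x = y by [].
  by apply: gdist_positivity; apply/le_anti; rewrite d0 gdist_ge0.
have [u [v [xe xu xv]]] : exists u v, [/\ on_edge u v x, 0 < x u & 0 < x v].
  case: (point_cases x) => [[w xw]|//].
  by case: nhx; rewrite xw; exact: horizontal_vertex.
have uv : u.1 = v.1.
  by case/orP: (xe.1) => [uv|/andP[/eqP//]]; case: nhx; exists u, v.
have px := proj_ver xe uv.
(* A point no farther from [x] than both ends of its vertical edge lies on that edge or coincides
   with one of the ends. *)
have ball h y : h <= x u -> h <= x v -> dist x y <= h -> proj y = proj x.
  move=> hu hv dy; rewrite px; case: (gdist_cut y xe) => [ye||].
  - exact: proj_ver ye uv.
  - rewrite (gdist_vertexl xe) => le; suff <- : #u = y by rewrite proj_vertex.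
    by apply: gdist_positivity; have := gdist_ge0 #u y; lra.
  - rewrite (gdist_vertexr xe) => le; suff <- : #v = y by rewrite proj_vertex uv.
    by apply: gdist_positivity; have := gdist_ge0 #v y; lra.
have s := on_edge_sum xe.
have [le|lt] := leP (x u) (x v).
  exists (x u, 0, #v); split; last by right; split=> //; [lra|exists v].
  - by rewrite (gdist_vertexr xe).
  - by rewrite px proj_vertex uv.
  - exact: horizontal_vertex.
  - by move=> y; apply: ball.
exists (x v, 0, #u); split; last by right; split=> //; [lra|exists u].
- by rewrite (gdist_vertexl xe).
- by rewrite px proj_vertex.
- exact: horizontal_vertex.
- by move=> y; apply: ball => //; lra.
Qed.

Definition fiber_height x := projT1 (cid (fiber_data_ex x)).
Definition ht x := (fiber_height x).1.1.
Definition kp x := (fiber_height x).1.2.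
Definition ctr x := (fiber_height x).2.

Lemma heightP x : [/\ dist x (ctr x) <= ht x, proj (ctr x) = proj x,
  horizontal (ctr x),
  forall y, dist x y <= ht x -> proj y = proj x &
      [/\ ht x = 0, kp x = 1 & horizontal x] \/
      [/\ 0 < ht x, ht x <= 1 / 2, kp x = 0, ~ horizontal x & exists e, ctr x = #e]].
Proof.
have := projT2 (cid (fiber_data_ex x)).
by rewrite /ht /kp /ctr -/(fiber_height x); case: (fiber_height x) => -[].
Qed.

Lemma ht_ge0 x : 0 <= ht x.
Proof. by case: (heightP x) => _ _ _ _ [[->]|[/ltW]]. Qed.

Lemma ht_le x : ht x <= 1 / 2.
Proof. by case: (heightP x) => _ _ _ _ [[-> _ _]|[_ //]]; lra. Qed.

(** Passing to the centres costs at most [ht x + ht y] and keeps the projections. The centre of a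
    non-horizontal point is a vertex, for which the comparison of distances is sharper. *)
Lemma dist_proj x y :
  dist x y <= dist1 (proj x) (proj y) + ht x + ht y \/
  dist x y <= 2 + ht x + ht y /\ dist1 (proj x) (proj y) <= kp x + kp y.
Proof.
case: (heightP x) => dx px hx _ cx; case: (heightP y) => dy py hy _ cy.
have t1 := gdist_triangle (ctr x) x y; have t2 := gdist_triangle (ctr y) (ctr x) y.
rewrite [dist (ctr y) y]gdist_sym in t2.
have := dist_horizontal hx hy; rewrite px py => -[le|[le1 le2]]; first by left; lra.
case: cx => [[hx0 kx _]|[hx0 _ kx _ [e cx]]]; case: cy => [[hy0 ky _]|[hy0 _ ky _ [f cy]]].
- by right; lra.
- have := dist_vertex_horizontal f hx; rewrite -cy px py.
  by case=> le; [left|right]; lra.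
- have := dist_vertex_horizontal e hy; rewrite -cx px py gdist_sym [dist1 (proj y) _]gdist_sym.
  by case=> le; [left|right]; lra.
have [ef|nef] := pselect (e.1 = f.1).
  right; split; first by lra.
  by rewrite -px -py cx cy !proj_vertex ef gdistxx; lra.
by have := dist_vertex_vertex nef; rewrite -cx -cy px py; left; lra.
Qed.

(** The projection is constant on end pieces of lengths [ht (g 0)] and [ht (g L)]; on the rest it is
    a 1-Lipschitz path that cannot be shortened. *)
Lemma proj_geodesic (L : R) (g : R -> X) : iso_on 0 L g ->
  ht (g 0) + ht (g L) < L ->
  dist (g 0) (g L) <= dist1 (proj (g 0)) (proj (g L)) + ht (g 0) + ht (g L) ->
  iso_on (ht (g 0)) (L - ht (g L)) (proj \o g : R -> X1) /\
  [/\ proj (g (ht (g 0))) = proj (g 0), proj (g (L - ht (g L))) = proj (g L) &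
   forall t, ht (g 0) <= t <= L - ht (g L) -> horizontal (g t)].
Proof.
set a := ht (g 0); set b := ht (g L) => giso abL.
have a0 : 0 <= a := ht_ge0 _; have b0 : 0 <= b := ht_ge0 _.
have gd s t : 0 <= s <= L -> 0 <= t <= L -> dist (g s) (g t) = `|s - t|.
  by move=> sI tI; apply: giso; rewrite in_itv.
rewrite gd; try lra.
rewrite ler0_norm; last lra.
move=> dL.
have pa : proj (g a) = proj (g 0).
  by case: (heightP (g 0)) => _ _ _ -> //; rewrite gd ?ler0_norm; lra.
have pb : proj (g (L - b)) = proj (g L).
  by case: (heightP (g L)) => _ _ _ -> //; rewrite gd ?ger0_norm; lra.
have iso' : iso_on 0 (L - b - a) (fun t => proj (g (t + a)) : X1).
  apply: lipschitz_iso; first lra.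
    move=> s t; rewrite !in_itv /= => sI tI.
    apply: le_trans (proj_lipschitz _ _) _; rewrite gd; try lra.
    by rewrite opprD addrACA subrr addr0.
  rewrite add0r subrK pa pb mdistE; lra.
have iso : iso_on a (L - b) (proj \o g : R -> X1).
  move=> s t; rewrite !in_itv /= => sI tI.
  have := iso' (s - a) (t - a); rewrite !in_itv /= !subrK => ->; try lra.
  by congr `|_|; lra.
split=> //; split=> // t tI.
case: (heightP (g t)) => _ _ _ H [[]//|[ht0 _ _ _ _]]; exfalso.
(* At a non-horizontal [g t] the projection would be constant on a ball of positive radius, against
   the isometry. *)
have [r [rI rt rh]] : exists r, [/\ a <= r <= L - b, r != t & `|t - r| <= ht (g t)].
  have [lt|ge] := ltP t (L - b).
    exists (t + Num.min (ht (g t)) (L - b - t)); split.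
    - by case: (leP (ht (g t)) (L - b - t)) => ?; lra.
    - by apply/eqP; case: (leP (ht (g t)) (L - b - t)) => ?; lra.
    - by case: (leP (ht (g t)) (L - b - t)) => ?; rewrite ?ler0_norm; lra.
  exists (t - Num.min (ht (g t)) (t - a)); split.
  - by case: (leP (ht (g t)) (t - a)) => ?; lra.
  - by apply/eqP; case: (leP (ht (g t)) (t - a)) => ?; lra.
  - by case: (leP (ht (g t)) (t - a)) => ?; rewrite ger0_norm; lra.
have E : proj (g r) = proj (g t) by apply: H; rewrite gd; lra.
have := iso r t; rewrite !in_itv /= E mdistxx => /(_ rI tI)/esym/eqP.
by rewrite normr_eq0 subr_eq0 (negPf rt).
Qed.

Lemma geodesic_iso (Y : metricType R) (s t : R) (g : R -> Y) : s <= t -> iso_on s t g ->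
  geodesic (g s) (g t) (g @` `[s, t]).
Proof.
move=> st giso; exists (t - s), (fun r => g (r + s)); split.
- lra.
- by rewrite add0r.
- by rewrite subrK.
- apply/seteqP; split=> q [r /=]; rewrite in_itv /= => rI <-.
    by exists (r - s); rewrite ?subrK //= in_itv /=; lra.
  by exists (r + s) => //=; rewrite in_itv /=; lra.
move=> i j; rewrite !in_itv /= => iI jI; rewrite giso ?in_itv /=; try lra.
by congr `|_|; lra.
Qed.

(** The roles of the ends differ: [x] is to be a corner on the long side, where lifting costs the
    height of [x], and [z] the opposite corner, reached only by comparing horizontal points. *)
Lemma proj_side x z S : geodesic (x : X) z S ->
  exists2 S1, geodesic (proj x : X1) (proj z) S1 & forall q : gpoint R G1, S1 q ->
  [\/ exists2 p, S p & horizontal p /\ proj p = q,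
      dist1 q (proj x) + ht x <= 1 |
      horizontal z /\ dist1 q (proj z) <= 1].
Proof.
move=> gS; have hx0 := ht_ge0 x; have hz0 := ht_ge0 z.
have hx1 := ht_le x; have hz1 := ht_le z.
case: (dist_proj x z) => [le|[_ le]].
  move: gS => [L [g [L0 gx gz SE giso]]].
  have gd s t : 0 <= s <= L -> 0 <= t <= L -> dist (g s) (g t) = `|s - t|.
    by move=> sI tI; apply: giso; rewrite in_itv.
  have [lt|ge] := ltP (ht x + ht z) L.
    have [] := @proj_geodesic L g giso; rewrite ?gx ?gz //.
    move=> iso [px pz hor]; have st : ht x <= L - ht z by lra.
    have := geodesic_iso st iso; rewrite /= px pz => gP.
    eexists; first exact: gP.
    move=> q [t /=]; rewrite in_itv /= => tI <-; apply: Or31.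
    exists (g t); last by split=> //; apply: hor.
    by rewrite SE; exists t => //=; rewrite in_itv /=; lra.
  (* The side is so short that the point at time [m] is within [ht x] of [x] and within [ht z] of
     [z], so both ends have the same projection. *)
  pose m := Num.min (ht x) L.
  have mx : m <= ht x by rewrite ge_min lexx.
  have mL : m <= L by rewrite ge_min lexx orbT.
  have m0 : 0 <= m by rewrite le_min hx0.
  have mz : L - m <= ht z by rewrite /m; case: (leP (ht x) L) => ?; lra.
  have p1 : proj (g m) = proj x.
    case: (heightP x) => _ _ _ H _; apply: H; rewrite -{1}gx gd; try lra.
    by rewrite ler0_norm; lra.
  have p2 : proj (g m) = proj z.
    case: (heightP z) => _ _ _ H _; apply: H; rewrite -{1}gz gd; try lra.
    by rewrite ger0_norm; lra.
  exists [set proj x]; first by rewrite -p2 p1; exact: geodesic1.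
  by move=> _ ->; apply: Or32; rewrite gdistxx; lra.
(* The projected ends are within [kp x + kp z], so any geodesic between them stays close enough to
   one of them. *)
have [S1 gS1] := geodesic_ex (proj x) (proj z).
exists S1 => // q /(geodesic_between gS1); rewrite [X in X + _ = _]metric_sym.
rewrite !mdistE => dq.
have d1 := gdist_ge0 q (proj x); have d2 := gdist_ge0 q (proj z).
case: (heightP x) (heightP z) => _ _ _ _ cx [_ _ _ _ cz].
case: cx => [[hx kx _]|[_ _ kx _ _]]; case: cz => [[hz kz zhor]|[_ _ kz _ _]].
- have [?|?] := leP (dist1 q (proj x)) 1; first by apply: Or32; lra.
  by apply: Or33; split=> //; lra.
- by apply: Or32; lra.
- have [?|?] := leP (dist1 q (proj x)) (1 / 2); first by apply: Or32; lra.
  by apply: Or33; split=> //; lra.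
- by apply: Or32; lra.
Qed.

(** The side is longer than 4, while the second case of [dist_proj] allows at most [2 + 1/2 + 1/2];
    and [p] avoids the end pieces, of length at most 1/2. *)
Lemma proj_long_side x y A p : geodesic (x : X) y A -> A p ->
  2 < dist p x -> 2 < dist p y ->
  exists A1, [/\ geodesic (proj x : X1) (proj y) A1, A1 (proj p), horizontal p,
    dist p x <= dist1 (proj p) (proj x) + ht x &
    dist p y <= dist1 (proj p) (proj y) + ht y].
Proof.
move=> gA Ap dx dy; have hx0 := ht_ge0 x; have hy0 := ht_ge0 y.
have hx1 := ht_le x; have hy1 := ht_le y.
have := geodesic_between gA Ap; rewrite [X in X + _ = _]metric_sym.
rewrite !mdistE => dp.
case: (dist_proj x y) => [le|[le _]]; last by lra.
move: gA Ap => [L [g [L0 gx gy -> giso]]] [t]; rewrite /= in_itv /= => tI gt.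
have gd r s : 0 <= r <= L -> 0 <= s <= L -> dist (g r) (g s) = `|r - s|.
  by move=> rI sI; apply: giso; rewrite in_itv.
have px : dist p x = t by rewrite -gt -gx gd ?ger0_norm; lra.
have py : dist p y = L - t by rewrite -gt -gy gd ?ler0_norm; lra.
have [] := @proj_geodesic L g giso; rewrite ?gx ?gy //; first lra.
move=> iso [ex ey hor]; have st : ht x <= L - ht y by lra.
have := geodesic_iso st iso; rewrite /= ex ey => gP.
have iso2 r s : ht x <= r <= L - ht y -> ht x <= s <= L - ht y ->
    dist1 (proj (g r)) (proj (g s)) = `|r - s|.
  by move=> rI sI; apply: iso; rewrite in_itv.
eexists; split; first exact: gP.
- by exists t; rewrite /= ?gt // in_itv /=; lra.
- by rewrite -gt; apply: hor; lra.
- by rewrite px -ex -gt iso2 ?ger0_norm; lra.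
- by rewrite py -ey -gt iso2 ?ler0_norm; lra.
Qed.

Lemma lex_delta_le (D : R) : hyp_const X1 = D%:E -> 3 / 4 <= D ->
  (hyp_const X <= (D + 5 / 4)%:E)%E.
Proof.
move=> hD D0; apply: hyp_const_le => [|x y z A B C gA gB gC p Ap e e0]; first lra.
have xC := geodesic_left gC; have yB := geodesic_left gB.
have zC := geodesic_right gC; have zB := geodesic_right gB.
have [dx|dx] := leP (dist p x) 2.
  by exists x; [right|rewrite mdistE; lra].
have [dy|dy] := leP (dist p y) 2.
  by exists y; [left|rewrite mdistE; lra].
have [A1 [gA1 A1p hp px py]] := proj_long_side gA Ap dx dy.
have [B1 gB1 B1P] := proj_side gB.
have [C1 gC1 C1P] := proj_side gC.
(* With this slack and a lifting cost of 1, the bound [D + 5/4] is at least 2, as [3/4 <= D], yet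
   remains below [D + 3/2]. *)
have e4 : 0 < 1 / 4 :> R by lra.
have [q q1 dq] := hyp_const_thin hD gA1 gB1 gC1 A1p e4.
rewrite mdistE in dq.
(* Here [d] bounds the distance from [q] to the projection of [r]. *)
have hor r (d : R) : horizontal r ->
    dist1 (proj p) (proj r) < D + 1 / 4 + d -> 0 <= d <= 1 -> dist p r < D + 5 / 4 + e.
  by move=> hr; case: (dist_horizontal hp hr) => [|[]]; lra.
have tri r := gdist_triangle q (proj p) (proj r).
case: q1 => [/B1P[[r Br [hr rq]]|le|[hz le]]|/C1P[[r Cr [hr rq]]|le|[hz le]]].
- by exists r; [left|apply: (hor _ 0) => //; rewrite ?rq; lra].
- by exists y; [left|rewrite mdistE; have := tri y; lra].
- by exists z; [left|apply: (hor _ 1) => //; have := tri z; lra].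
- by exists r; [right|apply: (hor _ 0) => //; rewrite ?rq; lra].
- by exists x; [right|rewrite mdistE; have := tri x; lra].
- by exists z; [right|apply: (hor _ 1) => //; have := tri z; lra].
Qed.

End product.

(** The levels from [u] exhibit a vertex other than [u]; the first step of a shortest walk to it is
    a neighbour. *)
Lemma not_tree_nbr (G : graph) : ~ is_tree G -> forall u : G, exists v, adj u v.
Proof.
move=> nt u; case: (not_tree_levels u nt) => [[w [a [b [aw _ _ la _]]]]|[a [b [ab lab]]]].
  have [|v uv _] := @dn_step _ (dn u a) u w; first by [].
  by exists v.
case En : (dn u a) => [|n]; last by have [v uv _] := dn_step En; exists v.
have := adj_neq ab; rewrite -(dn_eq0 En) -(dn_eq0 (_ : dn u b = 0%N)) ?eqxx //.
by rewrite -lab.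
Qed.

Theorem theorem3p20 (R : realType) (G1 G2 : graph)
    (hG1 : hyperbolic (metric_graph R G1))
    (hdelta : delta R (lex_product G1 G2) = (delta R G1 + (3 / 2)%:E)%E) :
  [/\ is_tree G1, ~ trivial_graph G2
    & delta R (lex_product G1 G2) = (3 / 2)%:E].
Proof.
have tree1 : is_tree G1.
  apply: contrapT => nt; case: (vert_inh G1) => v.
  have D0 := hyp_const_ge0 (vertex_point R v : metric_graph R G1).
  (* Hyperbolicity makes the constant a real number, so that adding 3/2 strictly increases it. *)
  have [D hD] : exists D : R, hyp_const (metric_graph R G1) = D%:E.
    by move: hG1 D0; rewrite /hyperbolic; case: (hyp_const _) => // D; exists D.
  have D34 := not_tree_delta nt hD.
  have := lex_delta_le G2 (not_tree_nbr nt) hD D34.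
  by rewrite -/(delta R _) hdelta /delta hD -EFinD lee_fin; lra.
have d1 : delta R G1 = 0%E := tree_delta R tree1.
(* A trivial [G2] would make the product a tree, with constant 0 instead of 3/2. *)
rewrite d1 add0e in hdelta; split=> // triv.
move: hdelta; rewrite /delta (tree_delta R (trivial_lex_tree tree1 triv)).
by move=> [] /eqP; rewrite lt_eqF //; lra.
Qed.
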